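(* Let $p\in[1,\infty)$, and let $(X_i,d_i,e_i)_{i\in\mathbb N}$ be a sequence of pointed metric spaces with metric ultralimit $(\hat X,\hat d)$. (1) Let $\mu^\omega,\nu^\omega\in\mathcal P_p(X)^\omega_{\lim}$ with $\mu^\omega\approx_{W_p^\omega}\nu^\omega$ (i.e. $W_p^\omega(\mu^\omega,\nu^\omega)\approx0$), with associated Loeb measures $\mu_L$ and $\nu_L$. Then, if the pushforwards $\mu_L\circ st_{\hat d}^{-1}$ and $\nu_L\circ st_{\hat d}^{-1}$ are both well-defined and belong to $\mathcal P_p(\hat X)$, they are equal. (2) Let $\mu^\omega\in\mathcal P_p(X)^\omega_{\lim}$ be a lifting of $\mu\in\mathcal P_p(\hat X)$. Let $\mu_L$ be the Loeb measure associated to $\mu^\omega$. Then, if $\mu_L\circ st_{\hat d}^{-1}$ is well-defined and belongs to $\mathcal P_p(\hat X)$, it holds that $\mu=\mu_L\circ st_{\hat d}^{-1}$.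
   Context: Fix a non-principal ultrafilter $\omega$ on $\mathbb N$. A property holds $\omega$-a.s. if the set of indices for which it holds belongs to $\omega$. $X^\omega=\prod_i X_i/\sim_\omega$ is the ultraproduct, classes written $[(x_i)]$; $\mathbb R^\omega$ is the ultrapower of $\mathbb R$; $a\approx b$ means $|a-b|<\varepsilon$ for every standard real $\varepsilon>0$; $st(a)$ is the real $r$ with $a\approx r$ (if $a$ is finite). Metric ultralimit: $d^\omega([(x_i)],[(y_i)])=[(d_i(x_i,y_i))]$, $e^\omega=[(e_i)]$, $X^\omega_{\lim}=\{x\in X^\omega:d^\omega(e^\omega,x)\text{ is finite}\}$; $\hat X$ is the quotient of $X^\omega_{\lim}$ by $d^\omega(x,y)\approx0$, with metric $\hat d$ induced by $st(d^\omega)$ and quotient map $st_{\hat d}:X^\omega_{\lim}\to\hat X$. For a metric space $Y$, $\mathcal P_p(Y)$ is the set of Radon probability measures on $Y$ with finite $p$th moment, and $W_p(\mu,\nu)=\inf_{\gamma\in\Pi(\mu,\nu)}\left(\int d(x,y)^p\,d\gamma\right)^{1/p}$, with $\Pi(\mu,\nu)$ the couplings. $\mathcal P_p(X)^\omega$ is the ultraproduct of the $\mathcal P_p(X_i)$, $W_p^\omega([(\mu_i)],[(\nu_i)])=[(W_p(\mu_i,\nu_i))]$, and $\mathcal P_p(X)^\omega_{\lim}$ is the set of $[(\mu_i)]$ with $W_p^\omega([(\mu_i)],[(\delta_{e_i})])$ finite. $(\widehat{\mathcal P_p(X)},\hat W_p)$ is the metric ultralimit of $(\mathcal P_p(X_i),W_p,\delta_{e_i})$,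 with quotient map $st_{\hat W_p}:\mathcal P_p(X)^\omega_{\lim}\to\widehat{\mathcal P_p(X)}$. The map $\iota:\mathcal P_p(\hat X)\to\widehat{\mathcal P_p(X)}$ is the isometric embedding given, for $\hat x_j=st_{\hat d}[(x_{j,i})_i]$, by $\iota\left(\frac1N\sum_{j=1}^N\delta_{\hat x_j}\right)=st_{\hat W_p}\left[\left(\frac1N\sum_{j=1}^N\delta_{x_{j,i}}\right)_{i}\right]$ and extended to $\mathcal P_p(\hat X)$ by density. A lifting of $\mu\in\mathcal P_p(\hat X)$ is a $\mu^\omega\in\mathcal P_p(X)^\omega_{\lim}$ with $st_{\hat W_p}(\mu^\omega)=\iota\mu$. Loeb measures: $\mathcal B^\omega$ is the algebra of internal Borel sets $B^\omega=[(B_i)]=\{[(x_i)]:x_i\in B_i\ \omega\text{-a.s.}\}$, $B_i\subseteq X_i$ Borel. For an internal probability measure $\mu^\omega=[(\mu_i)]$ put $\mu^\omega(B^\omega)=[(\mu_i(B_i))]$. Then $st\circ\mu^\omega$ is a premeasure on $\mathcal B^\omega$, and its (complete) Carathéodory extension $\mu_L=\mathrm{Loeb}(\mu^\omega)$ is the Loeb measure associated to $\mu^\omega$. The pushforward $\mu_L\circ st_{\hat d}^{-1}$ is well-defined when $st_{\hat d}^{-1}(B)$ is $\mu_L$-measurable for every Borel $B\subseteq\hat X$. *)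

(* Defs.v *)
From HB Require Import structures.
From mathcomp Require Import all_boot all_order all_algebra.
From mathcomp Require Import all_classical all_reals all_analysis.
From mathcomp Require Import measurable_realfun.
From mathcomp Require Import ring lra.
Import Order.TTheory GRing.Theory Num.Theory.
Import numFieldNormedType.Exports.

Set Implicit Arguments.
Unset Strict Implicit.
Unset Printing Implicit Defensive.

Local Open Scope classical_set_scope.
Local Open Scope ring_scope.
Local Open Scope quotient_scope.

Record nonprincipal_ultrafilter := NonprincipalUltrafilter {
  ultrafilter_sets :> set nat -> Prop;
  ultrafilter_sets_ultra : UltraFilter ultrafilter_sets;
  ultrafilter_sets_nonprincipal :
    forall n, ultrafilter_sets <> principal_filter n }.

#[global] Instance nonprincipal_ultrafilter_ultra
  (w : nonprincipal_ultrafilter) : UltraFilter w := ultrafilter_sets_ultra w.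

Section ultraproduct.
Context (w : nonprincipal_ultrafilter) (T : nat -> Type).

Definition xfamily := forall i, T i.
HB.instance Definition _ := gen_eqMixin xfamily.
HB.instance Definition _ := gen_choiceMixin xfamily.

Definition as_eq (x y : xfamily) : bool := `[< w [set i | x i = y i] >].

Lemma as_eq_refl : reflexive as_eq.
Proof. by move=> x; apply/asboolP; apply: filterS filterT => i _ /=. Qed.

Lemma as_eq_sym : symmetric as_eq.
Proof.
by move=> x y; apply/asboolP/asboolP; apply: filterS => i /= ->.
Qed.

Lemma as_eq_trans : transitive as_eq.
Proof.
move=> y x z /asboolP xy /asboolP yz; apply/asboolP.
by apply: filterS2 xy yz => i /= -> ->.
Qed.

Canonical as_eq_equiv := EquivRel as_eq as_eq_refl as_eq_sym as_eq_trans.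

Definition ultraproduct := {eq_quot as_eq}%qT.
HB.instance Definition _ := Choice.on ultraproduct.

Definition uclass (x : xfamily) : ultraproduct := \pi_ultraproduct x.

Definition urep (a : ultraproduct) : forall i, T i := repr a.

Lemma urepK a : uclass (urep a) = a.
Proof. exact: reprK. Qed.

Lemma uclassP (x y : xfamily) : uclass x = uclass y <-> w [set i | x i = y i].
Proof. by split=> [/eqmodP/asboolP|H]//; apply/eqmodP/asboolP. Qed.

Lemma urep_class (x : xfamily) : w [set i | urep (uclass x) i = x i].
Proof. by apply/uclassP; rewrite urepK. Qed.

End ultraproduct.
Arguments uclass w {T} x.

Section hyperreal.
Context (w : nonprincipal_ultrafilter) (R : realType).

Definition hyperreal := ultraproduct w (fun=> R).
Implicit Types a b : hyperreal.

Definition hstd (r : R) : hyperreal := uclass w (fun=> r).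

Definition happrox a b :=
  forall eps : R, 0 < eps -> w [set i | `|urep a i - urep b i| < eps].

Definition hfinite a := exists M : R, w [set i | `|urep a i| <= M].

Definition hst a : R := xget 0 [set r | happrox a (hstd r)].

Lemma happrox_stdP (x : nat -> R) (r : R) :
  happrox (uclass w x) (hstd r) <->
  forall eps : R, 0 < eps -> w [set i | `|x i - r| < eps].
Proof.
have xr : w [set i | urep (uclass w x) i = x i /\ urep (hstd r) i = r].
  by apply: filterI; exact: urep_class.
by split=> h eps eps0; apply: filterS2 xr (h _ eps0) => i /= [-> ->].
Qed.

Lemma hfiniteP (x : nat -> R) :
  hfinite (uclass w x) <-> exists M : R, w [set i | `|x i| <= M].
Proof.
by split=> -[M h]; exists M; apply: filterS2 (urep_class w x) h => i /= ->.
Qed.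

Lemma happrox_std_unique a r s :
  happrox a (hstd r) -> happrox a (hstd s) -> r = s.
Proof.
move=> ar ass; apply/eqP; rewrite -subr_eq0 -normr_le0; apply/ler_addgt0Pr.
move=> eps eps0; rewrite add0r.
have e2 : 0 < eps / 2 by rewrite divr_gt0.
rewrite -(urepK a) in ar ass.
move/happrox_stdP : ar => /(_ _ e2) ar.
move/happrox_stdP : ass => /(_ _ e2) ass.
have [i [/= h1 h2]] := filter_ex (filterI ar ass).
rewrite (_ : r - s = (urep a i - s) - (urep a i - r)); last first.
  by rewrite opprB [RHS]addrC addrA subrK.
by rewrite (le_trans (ler_normB _ _))// (splitr eps) lerD// ltW.
Qed.

Lemma hstE a r : happrox a (hstd r) -> hst a = r.
Proof.
move=> ar; apply: xget_unique => // s; exact/(fun h => happrox_std_unique h ar).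
Qed.

Lemma happrox_hst a : hfinite a -> happrox a (hstd (hst a)).
Proof.
move=> [M aM]; rewrite /hst; case: xgetP => // /(_ _) H; exfalso.
have cM := @segment_compact R (- M) M.
have FF : ProperFilter (fmap (urep a) w) by exact: fmap_proper_filter.
have /cM[r [_ rF]] : (fmap (urep a) w) `[- M, M]%classic.
  by apply: filterS aM => i /=; rewrite in_itv/= ler_norml.
apply: (H r); rewrite -[a]urepK; apply/happrox_stdP => eps eps0.
have [//|nw] := in_ultra_setVsetC [set i | `|urep a i - r| < eps]
  (ultrafilter_sets_ultra w).
have [z [/= z1 z2]] := rF (~` [set x | `|x - r| < eps]) _ nw
  (@nbhsx_ballx _ R r eps eps0).
by exfalso; apply: z1 => /=; rewrite distrC.
Qed.

End hyperreal.

Section ultralimit.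
Context (w : nonprincipal_ultrafilter) (R : realType) (T : nat -> Type).
Context (d : forall i, T i -> T i -> R) (e : forall i, T i).

Definition udist (x y : ultraproduct w T) : hyperreal w R :=
  uclass w (fun i => d (urep x i) (urep y i)).

Definition ulim := {x : ultraproduct w T | hfinite (udist (uclass w e) x)}.

(* The set of classes of the relation udist x y ~ 0.  Nothing is assumed of d
   here: the relation is an equivalence as soon as every d i is a
   pseudometric. *)
Definition uhat := {A : set ulim |
  exists x : ulim, A = [set y | happrox (udist (sval x) (sval y)) (hstd w 0)]}.

Definition st_hat (x : ulim) : uhat :=
  exist _ [set y | happrox (udist (sval x) (sval y)) (hstd w 0)]
    (ex_intro _ x erefl).

Definition uhat_rep (a : uhat) : ulim := sval (cid (svalP a)).

Definition uhat_dist (a b : uhat) : R :=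
  hst (udist (sval (uhat_rep a)) (sval (uhat_rep b))).

Lemma uhat_inj (a b : uhat) : sval a = sval b -> a = b.
Proof.
case: a b => [A hA] [B hB] /= AB; subst B.
by rewrite (Prop_irrelevance hA hB).
Qed.

Lemma uhat_repK a : st_hat (uhat_rep a) = a.
Proof. by apply: uhat_inj; rewrite /uhat_rep; case: cid => x /= ->. Qed.

HB.instance Definition _ := gen_eqMixin uhat.
HB.instance Definition _ := gen_choiceMixin uhat.

End ultralimit.

(* Pointed metric spaces; the base point is point. *)
#[short(type="pmetricType")]
HB.structure Definition PointedMetric (R : numDomainType) :=
  {T of Metric R T & isPointed T}.

Section ultralimit_of_metric_spaces.
Context (w : nonprincipal_ultrafilter) (R : realType).
Context (X : nat -> pmetricType R).

Local Notation d := (fun i => @mdist R (X i)).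
Local Notation e := (fun i => point : X i).

Definition uspace := ultraproduct w (fun i => X i).
Definition uspace_lim := @ulim w R (fun i => X i) d e.
Definition ultralimit := @uhat w R (fun i => X i) d e.
Definition st_ultralimit : uspace_lim -> ultralimit := @st_hat w R _ d e.
Definition ultralimit_dist : ultralimit -> ultralimit -> R :=
  @uhat_dist w R _ d e.

Lemma udist_mdistxx (x : uspace) : happrox (udist d x x) (hstd w 0).
Proof.
apply/happrox_stdP => eps eps0; apply: filterS filterT => i _ /=.
by rewrite mdistxx subr0 normr0.
Qed.

Lemma udist_mdist_sym (x y : uspace) : udist d x y = udist d y x.
Proof.
by apply/uclassP; apply: filterS filterT => i _ /=; rewrite metric_sym.
Qed.

Lemma udist_mdistP (x y : uspace) r :
  happrox (udist d x y) (hstd w r) <->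
  forall eps : R, 0 < eps ->
   w [set i | `|mdist (urep x i) (urep y i) - r| < eps].
Proof. exact: happrox_stdP. Qed.

Lemma uspace_lim_fin (x y : uspace_lim) : hfinite (udist d (sval x) (sval y)).
Proof.
case: x y => [x /hfiniteP[M xM]] [y /hfiniteP[N yN]] /=.
apply/hfiniteP; exists (M + N); apply: filterS2 xM yN => i /= xM yN.
rewrite ger0_norm ?mdist_ge0//.
rewrite (le_trans (metric_triangle _ (urep (uclass w e) i) _))// lerD//.
  by rewrite metric_sym (le_trans (ler_norm _)).
by rewrite (le_trans (ler_norm _)).
Qed.

Lemma happrox_uspace_lim (x y : uspace_lim) :
  happrox (udist d (sval x) (sval y))
    (hstd w (hst (udist d (sval x) (sval y)))).
Proof. exact/happrox_hst/uspace_lim_fin. Qed.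

Lemma hst_mdist_triangle (x y z : uspace_lim) :
  hst (udist d (sval x) (sval z)) <=
  hst (udist d (sval x) (sval y)) + hst (udist d (sval y) (sval z)).
Proof.
apply/ler_addgt0Pr => eps eps0.
have e3 : 0 < eps / 3 by rewrite divr_gt0.
have /udist_mdistP/(_ _ e3) h1 := happrox_uspace_lim x y.
have /udist_mdistP/(_ _ e3) h2 := happrox_uspace_lim y z.
have /udist_mdistP/(_ _ e3) h3 := happrox_uspace_lim x z.
have [i /= [[k1 k2] k3]] := filter_ex (filterI (filterI h1 h2) h3).
have := metric_triangle (urep (sval x) i) (urep (sval y) i) (urep (sval z) i).
move: k1 k2 k3; rewrite !ltr_norml => /andP[? ?] /andP[? ?] /andP[? ?].
lra.
Qed.

Lemma hst_mdist_ge0 (x y : uspace_lim) : 0 <= hst (udist d (sval x) (sval y)).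
Proof.
apply/ler_addgt0Pr => eps eps0.
have /udist_mdistP/(_ _ eps0) h1 := happrox_uspace_lim x y.
have [i /=] := filter_ex h1.
rewrite ltr_norml => /andP[_].
have := mdist_ge0 (urep (sval x) i) (urep (sval y) i).
lra.
Qed.

Lemma hst_mdistxx (x : uspace_lim) : hst (udist d (sval x) (sval x)) = 0.
Proof. exact/hstE/udist_mdistxx. Qed.

Lemma st_ultralimit_eq (x y : uspace_lim) :
  hst (udist d (sval x) (sval y)) = 0 -> st_ultralimit x = st_ultralimit y.
Proof.
move=> xy0; apply: uhat_inj => /=; apply/seteqP; split=> z /= xz.
  suff : hst (udist d (sval y) (sval z)) = 0.
    by have := happrox_uspace_lim y z => /[swap] ->.
  apply/eqP; rewrite eq_le hst_mdist_ge0 andbT.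
  rewrite (le_trans (hst_mdist_triangle y x z))//.
  by rewrite udist_mdist_sym xy0 add0r (hstE xz).
suff : hst (udist d (sval x) (sval z)) = 0.
  by have := happrox_uspace_lim x z => /[swap] ->.
apply/eqP; rewrite eq_le hst_mdist_ge0 andbT.
rewrite (le_trans (hst_mdist_triangle x y z))//.
by rewrite xy0 add0r (hstE xz).
Qed.

Lemma ultralimit_distxx x : ultralimit_dist x x = 0.
Proof. exact: hst_mdistxx. Qed.

Lemma ultralimit_dist_positivity x y : ultralimit_dist x y = 0 -> x = y.
Proof.
by move=> /st_ultralimit_eq; rewrite /st_ultralimit !uhat_repK.
Qed.

Lemma ultralimit_dist_sym x y : ultralimit_dist x y = ultralimit_dist y x.
Proof. by rewrite /ultralimit_dist /uhat_dist udist_mdist_sym. Qed.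

Lemma ultralimit_dist_triangle y x z :
  ultralimit_dist x z <= ultralimit_dist x y + ultralimit_dist y z.
Proof. exact: hst_mdist_triangle. Qed.

HB.instance Definition _ := Choice.on ultralimit.
HB.instance Definition _ := @isMetric.Build R ultralimit ultralimit_dist
  ultralimit_distxx ultralimit_dist_positivity ultralimit_dist_sym
  ultralimit_dist_triangle.

Lemma uspace_base_lim : hfinite (udist d (uclass w e) (uclass w e)).
Proof.
apply/hfiniteP; exists 0; apply: filterS filterT => i _ /=.
by rewrite mdistxx normr0.
Qed.

HB.instance Definition _ := isPointed.Build ultralimit
  (st_ultralimit (exist _ (uclass w e) uspace_base_lim)).

Lemma ultralimit_distE (x y : uspace_lim) :
  mdist (st_ultralimit x : ultralimit) (st_ultralimit y) =
  hst (udist d (sval x) (sval y)).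
Proof.
have rep x' : hst (udist d (sval (uhat_rep (st_ultralimit x'))) (sval x')) = 0.
  apply: hstE.
  have : sval (st_ultralimit (uhat_rep (st_ultralimit x'))) x'.
    by rewrite /st_ultralimit uhat_repK; exact: udist_mdistxx.
  by [].
rewrite /mdist/= /ultralimit_dist /uhat_dist.
apply/eqP; rewrite eq_le; apply/andP; split.
  rewrite (le_trans (hst_mdist_triangle _ x _))// rep add0r.
  rewrite (le_trans (hst_mdist_triangle _ y _))//.
  by rewrite [udist _ (sval y) _]udist_mdist_sym rep addr0.
rewrite (le_trans (hst_mdist_triangle _ (uhat_rep (st_ultralimit x)) _))//.
rewrite [udist _ (sval x) _]udist_mdist_sym rep add0r.
rewrite (le_trans (hst_mdist_triangle _ (uhat_rep (st_ultralimit y)) _))//.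
by rewrite rep addr0.
Qed.

End ultralimit_of_metric_spaces.

(* For T := A * B this is the Borel sigma-algebra of the product topology, which
   is larger than the product sigma-algebra when A and B are not separable. *)
Notation borel T := (g_sigma_algebraType (@open T)).

Section wasserstein.
Context (R : realType) (p : R) (T : pmetricType R).

Definition radon (mu : set (borel T) -> \bar R) :=
  forall B : set (borel T), measurable B ->
  mu B = ereal_sup [set mu K | K in [set K : set T | compact K /\ K `<=` B]].

(* By the triangle inequality the choice of x0 is immaterial. *)
Definition finite_moment (mu : {measure set (borel T) -> \bar R}) :=
  exists x0 : T, (\int[mu]_x (mdist x0 (x : T) `^ p)%:E < +oo)%E.

Record Pp := MkPp {
  Pp_prob :> probability (borel T) R;
  Pp_radon : radon Pp_prob;
  Pp_moment : finite_moment Pp_prob }.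

Definition couplings (mu nu : Pp) : set (probability (borel (T * T)%type) R) :=
  [set g : probability (borel (T * T)%type) R |
    forall A : set (borel T), measurable A ->
    g (fst @^-1` A) = mu A /\ g (snd @^-1` A) = nu A].

(* The infimum is finite: the product coupling exists since mu and nu are
   carried by sigma-compact sets, and the moments control its cost. *)
Definition Wp (mu nu : Pp) : R :=
  fine (ereal_inf [set (\int[g]_z (mdist (z.1 : T) z.2 `^ p)%:E) `^ (p^-1)
                   | g in couplings mu nu])%E.
End wasserstein.

Section measurable_mdist.
Context (R : realType) (T : pmetricType R).

Lemma measurable_mdist (x0 : T) :
  measurable_fun [set: borel T] (fun y : borel T => mdist x0 (y : T)).
Proof.
apply: (measurability _ (RGenInftyO.measurableE R)) => //.
move=> /= _ [_ [r ->]] <-; rewrite setTI; apply: sub_sigma_algebra.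
rewrite /= openE => y; rewrite /= in_itv/= => yr.
apply/nbhs_ballP; exists (r - mdist x0 (y : T)); first by rewrite /= subr_gt0.
move=> z; rewrite ballEmdist/= in_itv/= ltrBrDl => zr.
exact: le_lt_trans (metric_triangle _ _ _) zr.
Qed.

Lemma measurable_mdist_powR (p : R) (x0 : T) :
  measurable_fun [set: borel T]
    (EFin \o (fun y : borel T => mdist x0 (y : T) `^ p)).
Proof.
apply/measurable_EFinP.
apply: (@measurableT_comp _ _ _ _ _ _ (@powR R ^~ p)); last first.
  exact: measurable_mdist.
exact: measurable_powR.
Qed.

End measurable_mdist.

Section empirical.
Context (R : realType) (p : R) (T : pmetricType R).
Context (n : nat) (x : 'I_n.+1 -> T).

Definition empirical : set (borel T) -> \bar R :=
  mscale (n.+1%:R^-1)%:nng (msum (fun j => \d_(x (inord j) : borel T)) n.+1).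

HB.instance Definition _ := Measure.on empirical.

Lemma empiricalE (B : set (borel T)) :
  empirical B = ((n.+1%:R)^-1 * \sum_(j < n.+1) (\1_B (x j) : R))%:E.
Proof.
rewrite /empirical /mscale/= /msum EFinM; congr (_ * _)%E.
rewrite -sumEFin; apply: eq_bigr => j _; rewrite inord_val//.
Qed.

Lemma empirical_setT : empirical setT = 1%E.
Proof.
rewrite empiricalE; under eq_bigr do rewrite indicT.
by rewrite sumr_const card_ord mulVf.
Qed.

HB.instance Definition _ :=
  Measure_isProbability.Build _ _ _ empirical empirical_setT.

Lemma empirical_radon : radon empirical.
Proof.
move=> B mB; apply/eqP; rewrite eq_le; apply/andP; split.
  apply: ereal_sup_ubound; exists (B `&` range x).
    split=> [|y []//]; apply: finite_compact.
    by apply: finite_setIr; exact: finite_image.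
  rewrite !empiricalE; congr (_ * _)%:E; apply: eq_bigr => j _.
  rewrite !indicE; congr (nat_of_bool _)%:R; apply/idP/idP; rewrite !inE/=.
    by case.
  by move=> Bx; split => //; exists j.
apply: ge_ereal_sup => _ [K [_ KB] <-]; rewrite !empiricalE lee_fin.
apply: ler_wpM2l; rewrite ?invr_ge0//; apply: ler_sum => j _.
rewrite !indicE ler_nat; case: (boolP (x j \in K)) => //.
by rewrite inE => /KB Bx; rewrite mem_set.
Qed.

Lemma empirical_moment : finite_moment p empirical.
Proof.
have mf := @measurable_mdist_powR R T p.
exists point; rewrite /empirical ge0_integral_mscale//; last first.
- by move=> y _; rewrite lee_fin powR_ge0.
- exact: mf.
rewrite ge0_integral_measure_sum//; last first.
- exact: mf.
- by move=> y _; rewrite lee_fin powR_ge0.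
under eq_bigr => j _ do rewrite (integral_dirac _ _ (mf _))// diracT mul1e.
by rewrite sumEFin -EFinM ltry.
Qed.

Definition empirical_Pp : Pp p T :=
  MkPp empirical_radon empirical_moment.

End empirical.

Section dirac.
Context (R : realType) (p : R) (T : pmetricType R) (x : T).

Lemma dirac_empiricalE (B : set (borel T)) :
  (\d_(x : borel T))%R B = empirical (fun _ : 'I_1 => x : T) B :> \bar R.
Proof.
by rewrite (@empiricalE _ _ 0) big_ord1 invr1 mul1r.
Qed.

Lemma dirac_radon : radon (\d_(x : borel T) : set (borel T) -> \bar R).
Proof.
have -> : (\d_(x : borel T) : set (borel T) -> \bar R) =
    empirical (fun _ : 'I_1 => x : T).
  by apply/funext => B; exact: dirac_empiricalE.
exact: empirical_radon.
Qed.

Lemma dirac_moment :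
  finite_moment p (\d_(x : borel T) : {measure set _ -> \bar R}).
Proof.
exists x; rewrite integral_dirac//; last exact: measurable_mdist_powR.
by rewrite diracT mul1e ltry.
Qed.

Definition dirac_Pp : Pp p T := MkPp dirac_radon dirac_moment.

End dirac.

Section internal_borel_sets.
Context (w : nonprincipal_ultrafilter) (R : realType).
Context (X : nat -> pmetricType R).

Definition borel_family (B : forall i, set (X i)) :=
  forall i, measurable (B i : set (borel (X i))).

Definition internal_set (B : forall i, set (X i)) : set (uspace w X) :=
  [set x | w [set i | B i (urep x i)]].

Definition internal_borel : set (set (uspace w X)) :=
  [set A | exists B, borel_family B /\ A = internal_set B].

Lemma internal_setP (B : forall i, set (X i)) (x : forall i, X i) :
  internal_set B (uclass w x) <-> w [set i | B i (x i)].
Proof.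
have xr := @urep_class w (fun i => X i) x.
by split=> h; apply: filterS2 xr h => i /= ->.
Qed.

Lemma ultrafilter_setC (A : set nat) : w (~` A) <-> ~ w A.
Proof.
split=> [nA A1|nA]; last first.
  by have [] := in_ultra_setVsetC A (ultrafilter_sets_ultra w).
by have [i []] := filter_ex (filterI A1 nA).
Qed.

Lemma internal_setC B : ~` internal_set B = internal_set (fun i => ~` B i).
Proof.
by apply/seteqP; split => x /=; rewrite -ultrafilter_setC.
Qed.

Lemma internal_setI A B :
  internal_set A `&` internal_set B = internal_set (fun i => A i `&` B i).
Proof.
apply/seteqP; split => x /=.
  by move=> [a b]; exact: filterI.
by move=> h; split; apply: filterS h => i [].
Qed.

Lemma internal_setU A B :
  internal_set A `|` internal_set B = internal_set (fun i => A i `|` B i).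
Proof.
rewrite -[LHS]setCK setCU !internal_setC internal_setI internal_setC.
by congr internal_set; apply: functional_extensionality_dep => i;
  rewrite setCI !setCK.
Qed.

Lemma internal_set0 : internal_set (fun i => set0) = set0.
Proof.
by apply/seteqP; split => // x /= /filter_ex[].
Qed.

Lemma internal_set_inj A B : internal_set A = internal_set B ->
  w [set i | A i = B i].
Proof.
move=> AB; apply: contrapT => /ultrafilter_setC nAB.
pose P i (x : X i) := A i <> B i -> ~ (A i x <-> B i x).
have exP i : exists x, P i x.
  have [e|ne] := pselect (A i = B i); first by exists point => /(_ e).
  apply: contrapT => /forallNP h; apply: ne; apply/seteqP; split=> x Ax;
    apply: contrapT => nBx; apply: (h x) => _ []; tauto.
pose x i := sval (cid (exP i)).
have Px : w [set i | ~ (A i (x i) <-> B i (x i))].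
  by apply: filterS nAB => i; exact: (svalP (cid (exP i))).
have /ultrafilter_setC : ~ w [set i | A i (x i)].
  move=> Ax; have /internal_setP : internal_set B (uclass w x).
    by rewrite -AB; apply/internal_setP.
  move=> Bx; have [i /= [[]]] := filter_ex (filterI (filterI Ax Bx) Px).
  tauto.
move=> nAx; have /ultrafilter_setC : ~ w [set i | B i (x i)].
  move=> Bx; have /internal_setP Ax : internal_set A (uclass w x).
    by rewrite AB; apply/internal_setP.
  by move/ultrafilter_setC : nAx.
move=> nBx; have [i /= [[]]] := filter_ex (filterI (filterI nAx nBx) Px).
tauto.
Qed.

Lemma internal_borel0 : internal_borel set0.
Proof.
exists (fun=> set0); split; last by rewrite internal_set0.
by move=> i; exact: measurable0.
Qed.

Lemma internal_borelU : setU_closed internal_borel.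
Proof.
move=> _ _ [A [mA ->]] [B [mB ->]]; rewrite internal_setU.
exists (fun i => A i `|` B i); split => // i.
exact: measurableU (mA i) (mB i).
Qed.

Lemma internal_borelC : setC_closed internal_borel.
Proof.
move=> _ [A [mA ->]]; rewrite internal_setC.
by exists (fun i => ~` A i); split => // i; exact: measurableC (mA i).
Qed.

HB.instance Definition _ := Choice.on (uspace w X).
HB.instance Definition _ := isPointed.Build (uspace w X)
  (uclass w (fun i => point : X i)).
HB.instance Definition _ := @isAlgebraOfSets.Build default_measure_display
  (uspace w X) internal_borel internal_borel0 internal_borelU internal_borelC.

End internal_borel_sets.
Arguments internal_set w {R X} B.

Section saturation.
Context (w : nonprincipal_ultrafilter).

Lemma ultrafilter_ge (n : nat) : w [set i | (n <= i)%N].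
Proof.
elim: n => [|n IH]; first by apply: filterS filterT.
have [wn|wn] := in_ultra_setVsetC [set n] (ultrafilter_sets_ultra w).
  exfalso; apply: (@ultrafilter_sets_nonprincipal w n).
  have := principal_filter_ultra n => -[_ mx]; apply: mx => A.
  by move/principal_filterP => An; apply: filterS wn => _ ->.
apply: filterS2 IH wn => i /= ni /eqP ni'.
by rewrite ltn_neqAle eq_sym ni' ni.
Qed.

Context (R : realType) (X : nat -> pmetricType R).

(* Countable saturation, for decreasing sequences of internal sets. *)
Lemma internal_bigcap (B : nat -> forall i, set (X i)) :
  (forall n i, B n.+1 i `<=` B n i) ->
  (forall n, internal_set w (B n) !=set0) ->
  \bigcap_n internal_set w (B n) !=set0.
Proof.
move=> decB neB.
have decB' i m n : (m <= n)%N -> B n i `<=` B m i.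
  elim: n => [|n IH]; first by rewrite leqn0 => /eqP->.
  rewrite leq_eqVlt => /predU1P[->//|]; rewrite ltnS => /IH.
  exact: subset_trans (decB n i).
have ex i k : exists x : X i, forall n, (n <= k)%N -> B n i !=set0 -> B n i x.
  elim: k => [|k [x IH]].
    have [[x Bx]|n0] := pselect (B 0%N i !=set0).
      by exists x => n; rewrite leqn0 => /eqP->.
    by exists point => n; rewrite leqn0 => /eqP->.
  have [[y By]|n0] := pselect (B k.+1 i !=set0).
    by exists y => n nk _; exact: decB' nk _ By.
  exists x => n; rewrite leq_eqVlt => /predU1P[->//|].
  by rewrite ltnS; exact: IH.
pose x i := sval (cid (ex i i)).
exists (uclass w x) => n _; apply/internal_setP.
have [y yB] := neB n.
apply: filterS2 (ultrafilter_ge n) yB => i /= ni yBi.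
by apply: (svalP (cid (ex i i))) => //; exists (urep y i).
Qed.

End saturation.

Section loeb.
Context (w : nonprincipal_ultrafilter) (R : realType) (p : R).
Context (X : nat -> pmetricType R).
Implicit Type mu : ultraproduct w (fun i => Pp p (X i)).

Definition uprob mu (B : forall i, set (X i)) : hyperreal w R :=
  uclass w (fun i => fine (urep mu i (B i))).

(* The standard part of mu(A) for A internal Borel; the value does not depend on
   the family representing A by internal_set_inj. *)
Definition loeb_premeasure mu (A : set (uspace w X)) : \bar R :=
  xget 0%E [set (hst (uprob mu B))%:E | B in
    [set B | borel_family B /\ A = internal_set w B]].

Lemma loeb_premeasureE mu B : borel_family B ->
  loeb_premeasure mu (internal_set w B) = (hst (uprob mu B))%:E.
Proof.
move=> mB; apply: xget_unique; first by exists B.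
move=> _ [B' [mB' BB'] <-]; congr (hst _)%:E; apply/uclassP.
by apply: filterS (internal_set_inj BB') => i /= ->.
Qed.

Lemma uprob_finite mu B : borel_family B -> hfinite (uprob mu B).
Proof.
move=> mB; apply/hfiniteP; exists 1; apply: filterS filterT => i _ /=.
rewrite ger0_norm ?fine_ge0//.
rewrite -lee_fin fineK ?fin_num_measure//; last exact: mB.
exact: probability_le1 (mB i).
Qed.

Lemma hst_uprob_ge0 mu B : borel_family B -> 0 <= hst (uprob mu B).
Proof.
move=> mB; apply/ler_addgt0Pr => eps eps0.
have /happrox_stdP/(_ _ eps0) h := happrox_hst (uprob_finite mu mB).
have [i /=] := filter_ex h.
rewrite ltr_norml => /andP[_].
have : 0 <= fine (urep mu i (B i)) by rewrite fine_ge0.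
lra.
Qed.

Lemma loeb_premeasure0 mu : loeb_premeasure mu set0 = 0%E.
Proof.
have m0 : @borel_family R X (fun=> set0) by move=> i; exact: measurable0.
rewrite -(internal_set0 w X) loeb_premeasureE//; congr _%:E.
apply/hstE/happrox_stdP => eps eps0; apply: filterS filterT => i _ /=.
by rewrite measure0/= subr0 normr0.
Qed.

Lemma loeb_premeasure_ge0 mu A : (0 <= loeb_premeasure mu A)%E.
Proof.
rewrite /loeb_premeasure; case: xgetP => // _ -> [B [mB _] <-].
by rewrite lee_fin hst_uprob_ge0.
Qed.

Lemma loeb_premeasure_additive2 mu : additive2 (loeb_premeasure mu).
Proof.
move=> _ _ [A [mA ->]] [B [mB ->]] AB0.
have mU : borel_family (fun i => A i `|` B i).
  by move=> i; exact: measurableU (mA i) (mB i).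
have AB0' : w [set i | A i `&` B i = set0].
  have : internal_set w (fun i => A i `&` B i) = internal_set w (fun=> set0).
    by rewrite -internal_setI AB0 internal_set0.
  exact: internal_set_inj.
rewrite internal_setU !loeb_premeasureE// -EFinD; congr _%:E.
apply/hstE/happrox_stdP => eps eps0.
have e2 : 0 < eps / 2 by rewrite divr_gt0.
have /happrox_stdP/(_ _ e2) hA := happrox_hst (uprob_finite mu mA).
have /happrox_stdP/(_ _ e2) hB := happrox_hst (uprob_finite mu mB).
apply: filterS2 AB0' (filterI hA hB) => i /= ABi [].
rewrite measureU//; [|exact: mA|exact: mB].
rewrite fineD ?fin_num_measure//; [|exact: mA|exact: mB].
rewrite !ltr_norml => /andP[? ?] /andP[? ?]; lra.
Qed.

HB.instance Definition _ mu := isContent.Build _ _ _ (loeb_premeasure mu)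
  (loeb_premeasure_ge0 mu)
  ((additive2P (loeb_premeasure0 mu)).2 (loeb_premeasure_additive2 mu)).

Lemma loeb_premeasure_sigma_additive mu :
  semi_sigma_additive (loeb_premeasure mu).
Proof.
move=> F mF tF mU.
suff [n nF] : exists n, \bigcup_k F k = \big[setU/set0]_(i < n) F i.
  have F0 k : (n <= k)%N -> F k = set0.
    move=> nk; rewrite -subset0 => x Fkx.
    have : (\bigcup_k F k) x by exists k.
    rewrite nF -bigcup_mkord => -[j /= jn Fjx].
    have /tF : F j `&` F k !=set0 by exists x.
    by move=> /(_ Logic.I Logic.I) jk; move: jn; rewrite jk ltnNge nk.
  apply: cvg_near_cst; near=> m.
  have nm : (n <= m)%N by near: m; exists n.
  rewrite nF (measure_semi_additive (s := loeb_premeasure mu))//; last first.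
    exact: bigsetU_measurable.
  rewrite big_mkord -(subnKC nm) big_split_ord/=.
  rewrite [X in _ + X]big1 ?adde0// => i _.
  by rewrite F0 ?leq_addr// loeb_premeasure0.
have [U [mUU UE]] := mU.
have /choice[G GP] : forall k,
    exists B, borel_family B /\ F k = internal_set w B.
  by move=> k; exact: mF.
pose B n i := U i `\` \big[setU/set0]_(k < n) G k i.
have BE n : internal_set w (B n) =
    \bigcup_k F k `\` \big[setU/set0]_(k < n) F k.
  rewrite UE; elim: n => [|n IH].
    by rewrite big_ord0 setD0; congr internal_set;
      apply: functional_extensionality_dep => i; rewrite /B big_ord0 setD0.
  rewrite big_ord_recr/= setDUr -IH (GP n).2 setDE.
  rewrite internal_setC !internal_setI.
  congr internal_set; apply: functional_extensionality_dep => i.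
  by rewrite /B big_ord_recr/= setDUr -setDE.
apply: contrapT => /forallNP nex.
have [|n|x xB] := @internal_bigcap w R X B.
- move=> n i; apply: setDS; rewrite big_ord_recr/=; exact: subsetUl.
- rewrite BE; apply/set0P/eqP => e0; apply: (nex n).
  apply/seteqP; split; first by move: e0; rewrite setD_eq0.
  exact: bigsetU_bigcup.
- have := xB 0%N Logic.I; rewrite BE => -[[k _ Fkx] _].
  have := xB k.+1 Logic.I; rewrite BE => -[_].
  by apply; rewrite big_ord_recr/=; right.
Unshelve. all: by end_near. Qed.

HB.instance Definition _ mu := Content_isMeasure.Build _ _ _
  (loeb_premeasure mu) (@loeb_premeasure_sigma_additive mu).

Definition loeb_measurable mu : set (set (uspace w X)) :=
  ((loeb_premeasure mu)^*%mu).-cara.-measurable.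

Definition loeb mu : set (uspace w X) -> \bar R :=
  completed_measure_extension (mu := loeb_premeasure mu).

End loeb.

Section wasserstein_ultralimit.
Context (w : nonprincipal_ultrafilter) (R : realType) (p : R).
Context (X : nat -> pmetricType R).

Local Notation W := (fun i => @Wp R p (X i)).
Local Notation delta := (fun i => dirac_Pp p (point : X i)).

Definition uPp := ultraproduct w (fun i => Pp p (X i)).
Definition uWp : uPp -> uPp -> hyperreal w R := @udist w R _ W.
Definition uPp_lim := @ulim w R (fun i => Pp p (X i)) W delta.
Definition Pp_ultralimit := @uhat w R (fun i => Pp p (X i)) W delta.
Definition st_Pp_ultralimit : uPp_lim -> Pp_ultralimit := @st_hat w R _ W delta.
Definition Pp_ultralimit_dist : Pp_ultralimit -> Pp_ultralimit -> R :=
  @uhat_dist w R _ W delta.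

(* The defining properties of the embedding: it is isometric and prescribed on
   uniform measures over N.+1 points.  The latter are dense, so that there is
   at most one such map, namely the extension by density.  N.+1 points may be
   repeated. *)
Definition canonical_embedding
    (iota : Pp p (ultralimit w X) -> Pp_ultralimit) : Prop :=
  (forall mu nu, Pp_ultralimit_dist (iota mu) (iota nu) = Wp mu nu) /\
  (forall (N : nat) (x : 'I_N.+1 -> forall i, X i)
      (ux : 'I_N.+1 -> uspace_lim w X) (um : uPp_lim),
    (forall j, sval (ux j) = uclass w (x j)) ->
    sval um = uclass w (fun i => empirical_Pp p (fun j => x j i)) ->
    iota (empirical_Pp p (fun j => st_ultralimit (ux j) : ultralimit w X)) =
    st_Pp_ultralimit um).

Definition lifting (iota : Pp p (ultralimit w X) -> Pp_ultralimit)
    (um : uPp_lim) (mu : Pp p (ultralimit w X)) : Prop :=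
  st_Pp_ultralimit um = iota mu.

Definition st_preimage (B : set (ultralimit w X)) : set (uspace w X) :=
  [set sval x | x in @st_ultralimit w R X @^-1` B].

Definition loeb_pushforward (um : uPp)
    (B : set (borel (ultralimit w X))) : \bar R :=
  loeb um (st_preimage B).

Definition loeb_pushforward_well_defined (um : uPp) : Prop :=
  forall B : set (borel (ultralimit w X)), measurable B ->
  loeb_measurable um (st_preimage B).

End wasserstein_ultralimit.

(* A measure is determined by its values on Borel sets; its values elsewhere
   are junk. *)
Definition in_Pp (R : realType) (p : R) (T : pmetricType R)
    (m : set (borel T) -> \bar R) : Prop :=
  exists mu : Pp p T, forall B : set (borel T), measurable B -> mu B = m B.

(* Main.v *)
Require Import Defs.
From HB Require Import structures.
From mathcomp Require Import all_boot all_order all_algebra.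
From mathcomp Require Import all_classical all_reals all_analysis.
From mathcomp Require finmap.
From mathcomp Require Import measurable_realfun ring lra.
Import Order.TTheory GRing.Theory Num.Theory.
Import numFieldNormedType.Exports.

(** The theorem holds because a Radon probability measure on the ultralimit is
    determined by its values, up to small errors, on finite unions of balls,
    and these are the sets that have counterparts in the factors.

    Fix finitely many points of the ultralimit and representatives of them.
    The union of the r-balls around the points ([hat_net]) and the internal
    union of the r-balls around the representatives ([internal_net]) are
    related by the standard part map: the preimage of the former lies in the
    latter, and the latter lies in the preimage of the former for any larger
    radius ([st_preimage_hat_net], [internal_net_sub]).  The Loeb measure of an
    internal set being a standard part, the pushforward of the Loeb measure of
    a net is therefore squeezed between internal measures of nets.  A compact
    set K lies in a net that lies in a small neighbourhood of K, and these
    neighbourhoods decrease to K.  Hence [eq_pushforward]: if a Radon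
    probability measure gives each net at most the internal measure of the net
    of twice the radius plus an arbitrarily small error, it is bounded by the
    pushforward on compact sets, then on Borel sets, and two probability
    measures one of which is bounded by the other are equal.

    What remains is to verify this hypothesis, by Markov's inequality: if the
    Wasserstein distance of two measures is less than e^(1/p) r, some coupling
    moves a mass of at most e by r or more, so that the mass of a set under one
    measure is at most e plus the mass of its r-neighbourhood under the other
    ([Wp_lt_thicken]).  For (1) this is applied once, to the two internal
    measures.  For (2), mu is approximated by a uniform measure on finitely
    many points ([empirical_dense]), for which the claim is about nets
    containing points ([empirical_lift_hat_net]); the embedding being
    isometric, the lifting of mu and the internal uniform measure are close,
    and Markov's inequality is applied along the way from one to the other.
    These estimates hold in both directions, and those of successive steps
    add up in radius and mass.

    A strict upper bound on the Wasserstein distance yields a coupling only if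
    some coupling has finite cost; this is where the Radon property of measures
    on the factors is used ([couplings_neq0]). *)

Set Implicit Arguments.
Unset Strict Implicit.
Unset Printing Implicit Defensive.

Local Open Scope classical_set_scope.
Local Open Scope ring_scope.

(** * Neighbourhoods of sets, nets of compact sets *)

Section thickening.
Context (R : realType) (T : pmetricType R).
Implicit Types (A K : set T) (r s : R).

Definition thicken A r : set T := [set y | exists2 x, A x & mdist x y < r].

Lemma open_thicken A r : open (thicken A r).
Proof.
rewrite openE => y [x Ax xy]; apply/nbhs_ballP.
exists (r - mdist x y); first by rewrite /= subr_gt0.
move=> z; rewrite ballEmdist/= ltrBrDl => yz.
by exists x => //; exact: le_lt_trans (metric_triangle _ y _) yz.
Qed.

Lemma measurable_thicken A r : measurable (thicken A r : set (borel T)).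
Proof. by apply: sub_sigma_algebra; exact: open_thicken. Qed.

Lemma thicken_thicken A r s : thicken (thicken A r) s `<=` thicken A (r + s).
Proof.
move=> z [y [x Ax xy] yz]; exists x => //.
by rewrite (le_lt_trans (metric_triangle _ y _))// ltrD.
Qed.

Lemma thickenS A r s : (r <= s)%R -> thicken A r `<=` thicken A s.
Proof. by move=> rs y [x Ax xy]; exists x => //; exact: lt_le_trans xy rs. Qed.

(** The centres are taken in K: the net of radius r then stays within the
    r-neighbourhood of K.  They are listed by an index, in order to be lifted
    one by one to the factors. *)
Lemma compact_net K r : compact K -> 0 < r ->
  exists n (a : nat -> T), (forall j, (j < n)%N -> K (a j)) /\
    K `<=` thicken (a @` `I_n) r.
Proof.
rewrite compact_cover => cK r0.
have [|x Kx|D DK KD] := cK T K (ball^~ r).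
- move=> x _; rewrite ballEmdist.
  have -> : [set y | mdist x y < r] = thicken [set x] r.
    by apply/seteqP; split=> [y xy|y [_ -> //]]; exists x.
  exact: open_thicken.
- by exists x => //; exact: ballxx.
exists (size (finmap.enum_fset D)), (nth point (finmap.enum_fset D)); split=> [j jD|x /KD].
  by have /DK := mem_nth point jD; rewrite in_setE.
move=> [y /= yD]; rewrite ballEmdist/= => yx; exists y => //.
by exists (index y (finmap.enum_fset D)); rewrite /= ?index_mem ?nth_index.
Qed.

Lemma compact_measurable K : compact K -> measurable (K : set (borel T)).
Proof.
move=> cK; rewrite -[K]setCK; apply: (measurableC (T := borel T)).
apply: sub_sigma_algebra; apply: closed_openC.
exact: compact_closed (@metric_hausdorff _ T) cK.
Qed.

Lemma bigcap_thicken K : closed K -> \bigcap_n thicken K n.+1%:R^-1 = K.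
Proof.
move=> cK; apply/seteqP; split=> [y Ky|y Ky n _]; last first.
  by exists y => //; rewrite mdistxx.
apply: cK => B /nbhs_ballP[e /= e0 eB].
have [n _ /(_ n (leqnn _)) /= ne] := near_infty_natSinv_lt (PosNum e0).
have [x Kx xy] := Ky n Logic.I; exists x; split=> //; apply: eB.
by rewrite ballEmdist/= metric_sym (lt_trans xy).
Qed.

End thickening.

(** * Comparison of Radon probability measures *)

Section radon_comparison.
Context (R : realType) (T : pmetricType R).
Variables mu nu : probability (borel T) R.
Hypothesis radon_mu : radon mu.
Hypothesis mu_nu : forall (K : set T) (r e : R), compact K -> 0 < r -> 0 < e ->
  (mu K <= nu (thicken K r) + e%:E)%E.

(** The neighbourhoods of K of radius 1/n decrease to K, and nu is continuous
    from above. *)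
Lemma compact_le_of_thicken (K : set T) : compact K -> (mu K <= nu K)%E.
Proof.
move=> cK; have clK := compact_closed (@metric_hausdorff _ T) cK.
have mK := compact_measurable cK.
pose F n : set (borel T) := thicken K n.+1%:R^-1.
have capF : \bigcap_n F n = K by exact: bigcap_thicken.
have cvgF : (nu \o F) n @[n --> \oo] --> nu K.
  rewrite -capF; apply: nonincreasing_cvg_mu.
  - by rewrite (le_lt_trans (probability_le1 _ _)) ?ltry//; exact: measurable_thicken.
  - by move=> n; exact: measurable_thicken.
  - by rewrite capF.
  - move=> m n mn; apply/subsetPset/thickenS.
    by rewrite lef_pV2 ?posrE// ler_nat.
apply/lee_addgt0Pr => e e0.
have cvge : (nu \o F) n + e%:E @[n --> \oo] --> (nu K + e%:E)%E.
  by apply: cvgeD => //; [rewrite fin_num_adde_defl | exact: cvg_cst].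
have : (lim ((nu \o F) n + e%:E @[n --> \oo]) = nu K + e%:E)%E by exact/cvg_lim.
move=> <-; apply: lime_ge; first by apply/cvg_ex; exists (nu K + e%:E)%E.
by apply: nearW => n /=; exact: mu_nu.
Qed.

Lemma radon_le_of_thicken (B : set (borel T)) :
  measurable B -> (mu B <= nu B)%E.
Proof.
move=> mB; rewrite radon_mu//; apply: ge_ereal_sup => _ [K [cK KB] <-].
apply: (le_trans (compact_le_of_thicken cK)).
by apply: le_measure => //; rewrite inE//; exact: compact_measurable.
Qed.

(** Both measures have mass one, so an inequality on B and on its complement
    is an equality. *)
Lemma radon_eq_of_thicken (B : set (borel T)) : measurable B -> mu B = nu B.
Proof.
move=> mB; apply/eqP; rewrite eq_le radon_le_of_thicken//=.
have := radon_le_of_thicken (measurableC mB).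
rewrite !probability_setC//.
have := fin_num_measure mu _ mB; have := fin_num_measure nu _ mB.
by case: (mu B) (nu B) => [x| |] [y| |]//= _ _; rewrite -?EFinB ?lee_fin ?leNye ?leey//; lra.
Qed.

End radon_comparison.

(** * Existence of couplings of Radon measures *)

Lemma probability_setC0 d (S : measurableType d) (R : realType)
    (P : probability S R) (A : set S) :
  measurable A -> P A = 1%E -> P (~` A) = 0%E.
Proof. by move=> mA A1; rewrite probability_setC// A1 subee. Qed.

Lemma probability_setC_lt d (S : measurableType d) (R : realType)
    (P : probability S R) (A : set S) (e : R) :
  measurable A -> ((1 - e)%:E < P A)%E -> (P (~` A) < e%:E)%E.
Proof.
move=> mA; have fA : P A \is a fin_num by exact: fin_num_measure.
rewrite probability_setC//; move: fA.
by case: (P A) => //= r _; rewrite -?EFinB ?lte_fin; lra.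
Qed.

Lemma probability_setIl d (S : measurableType d) (R : realType)
    (P : probability S R) (A D : set S) :
  measurable A -> measurable D -> P D = 1%E -> P (A `&` D) = P A.
Proof.
move=> mA mD D1; rewrite [RHS](measureDI P mA mD) [X in (X + _)%E](_ : _ = 0%E).
  by rewrite add0e.
apply/eqP; rewrite eq_le measure_ge0 andbT.
have <- : P (~` D) = 0%E by exact: probability_setC0.
by apply: le_measure; rewrite ?inE ?setDE//; [apply: measurableI => //|];
  exact: measurableC.
Qed.

Lemma measurable_fun_generated d (S : measurableType d) (T : pointedType)
    (G : set (set T)) (f : S -> g_sigma_algebraType G) :
  (forall U, G U -> measurable (f @^-1` U)) -> measurable_fun setT f.
Proof.
move=> fG; apply: (measurability _ (erefl (measurable : set (set (g_sigma_algebraType G))))).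
by move=> _ [U GU <-]; rewrite setTI; exact: fG.
Qed.

Lemma measurable_fst_borel (R : realType) (T : pmetricType R) :
  measurable_fun setT (fst : borel (T * T)%type -> borel T).
Proof.
apply: measurable_fun_generated => U oU; apply: sub_sigma_algebra.
have /continuousP/(_ _ oU) : continuous (fst : T * T -> T).
  by move=> x; exact: cvg_fst.
by [].
Qed.

Lemma measurable_snd_borel (R : realType) (T : pmetricType R) :
  measurable_fun setT (snd : borel (T * T)%type -> borel T).
Proof.
apply: measurable_fun_generated => U oU; apply: sub_sigma_algebra.
have /continuousP/(_ _ oU) : continuous (snd : T * T -> T).
  by move=> x; exact: cvg_snd.
by [].
Qed.

Lemma measurable_preimageT d d' (S : measurableType d) (T : measurableType d')
    (f : S -> T) (A : set T) :
  measurable_fun setT f -> measurable A -> measurable (f @^-1` A).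
Proof. by move=> mf mA; rewrite -[X in measurable X]setTI; exact: mf. Qed.

Section product_coupling.
Context (R : realType) (T : pmetricType R).

(** Compact sets are separable, so on K x L an open set is a countable union of
    open rectangles, which are centred at points of finite nets.  Without the
    restriction to K x L, Borel sets of the product need not belong to the
    product sigma-algebra. *)
Lemma measurable_open_compact_rectangle (U : set (T * T)) (K L : set T) :
  open U -> compact K -> compact L ->
  measurable (U `&` K `*` L : set (borel T * borel T)%type).
Proof.
move=> oU cK cL.
have net (C : set T) : compact C -> exists a : nat -> nat -> T,
    forall k x, C x -> exists i, mdist (a k i) x < k.+1%:R^-1.
  move=> cC; have /choice[a aC] : forall k : nat, exists a : nat -> T,
      forall x, C x -> exists i, mdist (a i) x < k.+1%:R^-1.
    move=> k; have [|n [a [_ Ca]]] := @compact_net _ _ C k.+1%:R^-1 cC.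
      by rewrite invr_gt0.
    by exists a => x /Ca[_ [i _ <-] ix]; exists i.
  by exists a.
have [a aK] := net K cK; have [b bL] := net L cL.
pose V k i j : set (borel T * borel T) :=
  thicken [set a k i] k.+1%:R^-1 `*` thicken [set b k j] k.+1%:R^-1.
have mV k i j : measurable (V k i j).
  by apply: measurableX; exact: measurable_thicken.
have -> : U `&` K `*` L = (\bigcup_k \bigcup_i
    \bigcup_(j in [set j | V k i j `<=` U]) V k i j) `&` K `*` L.
  apply/seteqP; split=> -[x y] [] /=; last first.
    by move=> [k _ [i _ [j /= VU Vxy]]] KLxy; split => //; exact: VU.
  move=> Uxy [Kx Ly]; split=> //.
  move: oU; rewrite openE => /(_ _ Uxy)/nbhs_ballP[e /= e0 eU].
  have e2 : 0 < e / 2 by rewrite divr_gt0.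
  have [k _ /(_ k (leqnn _)) /= ke] := near_infty_natSinv_lt (PosNum e2).
  have [i ix] := aK k x Kx; have [j jy] := bL k y Ly.
  exists k => //; exists i => //; exists j; last first.
    by split; [exists (a k i)|exists (b k j)].
  move=> [x' y'] [[_ -> ix'] [_ -> jy']]; apply: eU; split => /=;
    rewrite ballEmdist/=.
    rewrite (le_lt_trans (metric_triangle _ (a k i) _))// metric_sym.
    by rewrite (lt_trans (ltrD ix ix'))// [e]splitr ltrD.
  rewrite (le_lt_trans (metric_triangle _ (b k j) _))// metric_sym.
  by rewrite (lt_trans (ltrD jy jy'))// [e]splitr ltrD.
apply: measurableI.
  do 3 (apply: bigcup_measurable => ? _); exact: mV.
by apply: measurableX; exact: compact_measurable.
Qed.

(** Take compact sets of mass greater than 1 - 1/n. *)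
Lemma radon_sigma_compact (mu : probability (borel T) R) : radon mu ->
  exists K : nat -> set T, (forall n, compact (K n)) /\ mu (\bigcup_n K n) = 1%E.
Proof.
move=> rmu.
have /choice[K KP] : forall n : nat, exists K : set T,
    compact K /\ ((1 - n.+1%:R^-1)%:E < mu K)%E.
  move=> n.
  have : ((1 - n.+1%:R^-1)%:E < mu setT)%E.
    by rewrite probability_setT lte_fin ltrBlDr ltrDl invr_gt0.
  rewrite rmu// => /ereal_sup_gt[_ [K [cK _] <-] nK].
  by exists K.
exists K; split=> [n|]; first by have [] := KP n.
have mS : measurable (\bigcup_n K n : set (borel T)).
  by apply: bigcupT_measurable => n; apply: compact_measurable; have [] := KP n.
apply/eqP; rewrite eq_le probability_le1//=.
apply/lee_subgt0Pr => e e0.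
have [n _ /(_ n (leqnn _)) /= ne] := near_infty_natSinv_lt (PosNum e0).
have [cKn /ltW Kn] := KP n.
apply: (@le_trans _ _ (1 - n.+1%:R^-1)%:E).
  by rewrite -EFinB lee_fin lerD2l lerN2 ltW.
apply: (le_trans Kn); apply: le_measure; rewrite ?inE//.
  exact: compact_measurable.
exact: bigcup_sup.
Qed.

(** The product measure is defined on the product sigma-algebra only.  Both
    marginals are carried by countable unions of compact sets, on the product D
    of which every Borel set of T x T is in the product sigma-algebra.  So the
    map that is the identity on D and constant elsewhere is measurable into the
    Borel sigma-algebra, and it carries the product measure to a coupling. *)
Lemma couplings_neq0 p (mu nu : Pp p T) : couplings mu nu !=set0.
Proof.
have [K [cK K1]] := radon_sigma_compact (@Pp_radon _ _ _ mu).
have [L [cL L1]] := radon_sigma_compact (@Pp_radon _ _ _ nu).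
pose D : set (borel T * borel T) := (\bigcup_n K n) `*` (\bigcup_n L n).
have mK : measurable (\bigcup_n K n : set (borel T)).
  by apply: bigcupT_measurable => n; exact: compact_measurable.
have mL : measurable (\bigcup_n L n : set (borel T)).
  by apply: bigcupT_measurable => n; exact: compact_measurable.
have mD : measurable D by exact: measurableX.
pose h (z : borel T * borel T) : borel (T * T)%type :=
  if z \in D then z else (point, point).
have mUD (U : set (T * T)) : open U ->
    measurable (U `&` D : set (borel T * borel T)).
  move=> oU; have -> : U `&` D = \bigcup_m \bigcup_n (U `&` K m `*` L n).
    apply/seteqP; split=> [z [Uz [[m _ Km] [n _ Ln]]]|].
      by exists m => //; exists n.
    by move=> z [m _ [n _ [Uz [Km Ln]]]]; split=> //; split; [exists m|exists n].
  by do 2 (apply: bigcup_measurable => ? _);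
    exact: measurable_open_compact_rectangle.
have mh : measurable_fun setT h.
  apply: measurable_fun_generated => U oU.
  have [Up|Up] := pselect (U (point, point)).
    have -> : h @^-1` U = (U `&` D) `|` ~` D.
      apply/seteqP; split=> z; rewrite /h/=.
        by case: ifPn; rewrite ?in_setE ?notin_setE => Dz Uz; [left|right].
      move=> [[Uz Dz]|Dz]; first by rewrite mem_set.
      by rewrite memNset.
    by apply: measurableU; [exact: mUD|exact: measurableC].
  have -> : h @^-1` U = U `&` D.
    apply/seteqP; split=> z; rewrite /h/=.
      by case: ifPn; rewrite ?in_setE ?notin_setE.
    by move=> [Uz Dz]; rewrite mem_set.
  exact: mUD.
pose hm : {mfun (borel T * borel T)%type >-> borel (T * T)%type} :=
  HB.pack h (isMeasurableFun.Build _ _ _ _ _ mh).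
have prodD : (mu \x nu)%E D = 1%E.
  rewrite product_measure1E//.
  by rewrite -[RHS]mule1; congr (_ * _)%E; [exact: K1|exact: L1].
(* The map h is the identity on D, which carries the product measure. *)
have hE (E : set (borel T * borel T)) (F : set (borel (T * T)%type)) :
    measurable E -> measurable F -> (forall z, F z <-> E z) ->
    distribution (mu \x nu)%E hm F = (mu \x nu)%E E.
  move=> mE mF EF; rewrite /distribution /pushforward.
  have mhF : measurable (h @^-1` F) by apply: measurable_preimageT mF.
  rewrite -(probability_setIl mhF mD prodD) -[RHS](probability_setIl mE mD prodD).
  congr ((mu \x nu)%E _); apply/seteqP; split=> z [Fz Dz]; split=> //.
    by move: Fz; rewrite /= /h mem_set// EF.
  by rewrite /= /h mem_set// EF.
exists (distribution (mu \x nu)%E hm) => A mA; split.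
  transitivity ((mu \x nu)%E (A `*` setT)).
    apply: hE; last by move=> z; split=> [|[]].
      exact: measurableX.
    exact: measurable_preimageT (@measurable_fst_borel R T) mA.
  by rewrite product_measure1E// -[RHS]mule1; congr (_ * _)%E; exact: probability_setT.
transitivity ((mu \x nu)%E (setT `*` A)).
  apply: hE; last by move=> z; split=> [|[]].
    exact: measurableX.
  exact: measurable_preimageT (@measurable_snd_borel R T) mA.
by rewrite product_measure1E// -[RHS]mul1e; congr (_ * _)%E; exact: probability_setT.
Qed.

End product_coupling.

(** * Transport cost and Wasserstein distance *)

(** One half of the condition that the Levy-Prokhorov distance of the measures
    is small, with separate parameters for radius and mass. *)
Definition thicken_le (R : realType) (T : pmetricType R) (r e : R)
    (mu nu : set (borel T) -> \bar R) :=
  forall A : set (borel T), measurable A ->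
    (mu A <= nu (thicken A r) + e%:E)%E.

Section transport_cost.
Context (R : realType) (p : R) (T : pmetricType R).
Hypothesis p_gt0 : 0 < p.

Let p_ge0 : 0 <= p. Proof. exact: ltW. Qed.
Let p_neq0 : p != 0. Proof. by rewrite gt_eqF. Qed.

Definition cost (g : set (borel (T * T)%type) -> \bar R) : \bar R :=
  (\int[g]_z (mdist (z.1 : T) z.2 `^ p)%:E)%E.

Lemma measurable_mdist_pair :
  measurable_fun setT (fun z : borel (T * T)%type => mdist (z.1 : T) z.2).
Proof.
apply: (measurability _ (RGenInftyO.measurableE R)) => //.
move=> /= _ [_ [r ->]] <-; rewrite setTI; apply: sub_sigma_algebra.
rewrite /= openE => -[x y]; rewrite /= in_itv/= => xyr.
have r2 : 0 < (r - mdist x y) / 2 by rewrite divr_gt0// subr_gt0.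
apply/nbhs_ballP; exists ((r - mdist x y) / 2) => //.
move=> [x' y'] [] /=; rewrite !ballEmdist/= in_itv/= => xx' yy'.
have := metric_triangle x' x y'; have := metric_triangle x y y'.
rewrite (metric_sym x' x); lra.
Qed.

Lemma measurable_cost :
  measurable_fun setT (fun z : borel (T * T)%type => (mdist (z.1 : T) z.2 `^ p)%:E).
Proof.
apply/measurable_EFinP.
apply: (@measurableT_comp _ _ _ _ _ _ (@powR R ^~ p)); last first.
  exact: measurable_mdist_pair.
exact: measurable_powR.
Qed.

Lemma cost_ge0 (g : {measure set (borel (T * T)%type) -> \bar R}) :
  (0 <= cost g)%E.
Proof. by apply: integral_ge0 => z _; rewrite lee_fin powR_ge0. Qed.

Lemma powRD_le (a b : R) : 0 <= a -> 0 <= b ->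
  (a + b) `^ p <= 2 `^ p * (a `^ p + b `^ p).
Proof.
move=> a0 b0; wlog ab : a b a0 b0 / a <= b.
  move=> wl; have [ab|/ltW ba] := leP a b; first exact: wl.
  by rewrite addrC [X in _ * X]addrC; exact: wl.
apply: (@le_trans _ _ ((2 * b) `^ p)).
  by apply: ge0_ler_powR; rewrite ?nnegrE ?addr_ge0 ?mulr_ge0//; lra.
by rewrite powRM// ler_wpM2l ?powR_ge0// lerDr powR_ge0.
Qed.

Definition moment (mu : set (borel T) -> \bar R) (x : T) : \bar R :=
  (\int[mu]_y (mdist x (y : T) `^ p)%:E)%E.

Lemma moment_lty (mu : Pp p T) x : (moment mu x < +oo)%E.
Proof.
have [x0 mu0] := @Pp_moment _ _ _ mu.
have mf := @measurable_mdist_powR R T p.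
have nneg y z : (0 <= (mdist y z `^ p)%:E :> \bar R)%E.
  by rewrite lee_fin powR_ge0.
apply: (@le_lt_trans _ _ (\int[mu]_y ((2 `^ p)%:E *
    ((mdist x x0 `^ p)%:E + (mdist x0 (y : T) `^ p)%:E)))%E).
  apply: ge0_le_integral => //=.
  - exact: mf.
  - apply: emeasurable_funM => //; apply: emeasurable_funD => //; exact: mf.
  - move=> y _; rewrite -EFinD -EFinM lee_fin.
    apply: le_trans (powRD_le (mdist_ge0 _ _) (mdist_ge0 _ _)).
    apply: ge0_ler_powR; rewrite ?nnegrE ?addr_ge0 ?mdist_ge0//.
    exact: metric_triangle.
rewrite ge0_integralZl//; last first.
- by move=> y _; rewrite adde_ge0.
- apply: emeasurable_funD => //; exact: mf.
rewrite ge0_integralD//; last exact: mf.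
rewrite integral_cst// [X in (_ * X + _)%E](_ : _ = 1%E); last first.
  exact: probability_setT.
rewrite mule1.
by rewrite lte_mul_pinfty ?lee_fin ?powR_ge0// lte_add_pinfty ?ltry.
Qed.

Section one_coupling.
Variables (mu nu : Pp p T) (g : probability (borel (T * T)%type) R).
Hypothesis gc : couplings mu nu g.

Lemma integral_coupling_fst (f : borel T -> \bar R) :
  measurable_fun setT f -> (forall y, 0 <= f y)%E ->
  (\int[g]_z f z.1 = \int[mu]_y f y)%E.
Proof.
move=> mf f0; have m1 := @measurable_fst_borel R T.
rewrite -[LHS](ge0_integral_pushforward m1 g measurableT mf) => [|y _]; last exact: f0.
apply: eq_measure_integral => A mA _; exact: (gc mA).1.
Qed.

Lemma integral_coupling_snd (f : borel T -> \bar R) :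
  measurable_fun setT f -> (forall y, 0 <= f y)%E ->
  (\int[g]_z f z.2 = \int[nu]_y f y)%E.
Proof.
move=> mf f0; have m2 := @measurable_snd_borel R T.
rewrite -[LHS](ge0_integral_pushforward m2 g measurableT mf) => [|y _]; last exact: f0.
apply: eq_measure_integral => A mA _; exact: (gc mA).2.
Qed.

(** By the triangle inequality through x.  In particular every coupling has
    finite cost. *)
Lemma cost_le_moments x :
  (cost g <= (2 `^ p)%:E * (moment mu x + moment nu x))%E.
Proof.
have mf := @measurable_mdist_powR R T p.
have nneg y z : (0 <= (mdist y z `^ p)%:E :> \bar R)%E.
  by rewrite lee_fin powR_ge0.
rewrite /moment -(integral_coupling_fst (mf x)) => [|y]; last exact: nneg.
rewrite -(integral_coupling_snd (mf x)) => [|y]; last exact: nneg.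
have mf1 := measurableT_comp (mf x) (@measurable_fst_borel R T).
have mf2 := measurableT_comp (mf x) (@measurable_snd_borel R T).
rewrite -ge0_integralD//= -ge0_integralZl//=; last first.
- by move=> y _; rewrite adde_ge0.
- by apply: emeasurable_funD.
apply: ge0_le_integral => //=.
- exact: measurable_cost.
- by apply: emeasurable_funM => //; apply: emeasurable_funD.
- move=> z _; rewrite -EFinD -EFinM lee_fin.
  apply: le_trans (powRD_le (mdist_ge0 _ _) (mdist_ge0 _ _)).
  apply: ge0_ler_powR; rewrite ?nnegrE ?addr_ge0 ?mdist_ge0//.
  by rewrite (metric_sym x z.1) metric_triangle.
Qed.

Lemma cost_lty : (cost g < +oo)%E.
Proof.
apply: (le_lt_trans (cost_le_moments point)).
rewrite lte_mul_pinfty ?lee_fin ?powR_ge0//.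
by rewrite lte_add_pinfty// moment_lty.
Qed.

Lemma measurable_far r :
  measurable [set z : borel (T * T)%type | (r <= mdist (z.1 : T) z.2)%R].
Proof.
have := measurable_preimageT measurable_mdist_pair (@measurable_itv R `[r, +oo[).
by congr measurable; apply/seteqP; split=> z /=; rewrite in_itv/= andbT.
Qed.

Lemma markov_cost r : 0 < r ->
  ((r `^ p)%:E * g [set z | (r <= mdist (z.1 : T) z.2)%R] <= cost g)%E.
Proof.
move=> r0; rewrite /cost.
have mE := measurable_far r.
rewrite -integral_cst//.
apply: (@le_trans _ _ (\int[g]_(z in [set z | (r <= mdist (z.1 : T) z.2)%R])
    (mdist (z.1 : T) z.2 `^ p)%:E)%E).
  apply: ge0_le_integral => //=.
  - by move=> z _; rewrite lee_fin powR_ge0.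
  - by apply: measurable_funTS; exact: measurable_cost.
  - move=> z rz; rewrite lee_fin.
    by apply: ge0_ler_powR; rewrite ?nnegrE ?mdist_ge0 ?(ltW r0).
apply: ge0_subset_integral => //; first exact: measurable_cost.
by move=> z _; rewrite lee_fin powR_ge0.
Qed.

Lemma coupling_far r e : 0 < r -> (cost g <= (e * r `^ p)%:E)%E ->
  (g [set z | (r <= mdist (z.1 : T) z.2)%R] <= e%:E)%E.
Proof.
move=> r0 ge; have := le_trans (markov_cost r0) ge.
by rewrite muleC EFinM lee_pmul2r// lte_fin powR_gt0.
Qed.

(** If z.1 is in A, then z.2 is in the r-neighbourhood of A unless z.1 and z.2
    are at distance at least r; and likewise with the coordinates exchanged. *)
Lemma coupling_thicken r e : 0 < r -> (cost g <= (e * r `^ p)%:E)%E ->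
  thicken_le r e mu nu /\ thicken_le r e nu mu.
Proof.
move=> r0 /(coupling_far r0) far; have mfar := measurable_far r.
have m1 := @measurable_fst_borel R T; have m2 := @measurable_snd_borel R T.
split=> A mA; have mtA := measurable_thicken A r.
  rewrite -(gc mA).1 -(gc mtA).2.
  apply: le_trans (leeD2l _ far).
  apply: le_trans (measureU2 _ _ _) => //; try exact: measurable_preimageT.
  apply: le_measure; rewrite ?inE; try exact: measurable_preimageT.
    by apply: measurableU => //; exact: measurable_preimageT.
  move=> z /= Az; have [zr|rz] := ltP (mdist (z.1 : T) z.2) r; [left|right] => //.
  by exists z.1.
rewrite -(gc mA).2 -(gc mtA).1.
apply: le_trans (leeD2l _ far).
apply: le_trans (measureU2 _ _ _) => //; try exact: measurable_preimageT.
apply: le_measure; rewrite ?inE; try exact: measurable_preimageT.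
  by apply: measurableU => //; exact: measurable_preimageT.
move=> z /= Az; have [zr|rz] := ltP (mdist (z.1 : T) z.2) r; [left|right] => //.
by exists z.2 => //; rewrite metric_sym.
Qed.

End one_coupling.

Lemma Wp_ge0 (mu nu : Pp p T) : 0 <= Wp mu nu.
Proof.
by apply: fine_ge0; apply: le_ereal_inf_tmp => _ [g _ <-]; exact: poweR_ge0.
Qed.

(** The infimum in the definition is turned into a real number by fine, which
    maps an infinite value to 0; it is finite because couplings exist and have
    finite cost. *)
Lemma Wp_lt_coupling (mu nu : Pp p T) e : Wp mu nu < e ->
  exists2 g, couplings mu nu g & (cost g <= (e `^ p)%:E)%E.
Proof.
move=> We; have e0 := le_lt_trans (Wp_ge0 mu nu) We.
have [g0 g0c] := couplings_neq0 mu nu.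
have inf_fin : (ereal_inf [set (cost g) `^ p^-1 | g in couplings mu nu] \is a fin_num)%E.
  rewrite ge0_fin_numE; last by apply: le_ereal_inf_tmp => _ [g _ <-]; exact: poweR_ge0.
  apply: le_lt_trans (poweR_lty p^-1 (cost_lty g0c)).
  by apply: ereal_inf_lbound; exists g0.
have : (ereal_inf [set (cost g) `^ p^-1 | g in couplings mu nu] < e%:E)%E.
  by rewrite -(fineK inf_fin) lte_fin.
move=> /ereal_inf_lt[_ [g gc <-] ge]; exists g => //.
have [g_fin g0'] : cost g \is a fin_num /\ (0 <= cost g)%E.
  by rewrite ge0_fin_numE cost_ge0// (cost_lty gc).
rewrite -(fineK g_fin) lee_fin; have : (fine (cost g)) `^ p^-1 < e.
  by move: ge; rewrite -{1}(fineK g_fin) poweR_EFin lte_fin.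
move=> /ltW/(ge0_ler_powR p_ge0 _ _).
rewrite !nnegrE powR_ge0 (ltW e0) => /(_ isT isT).
by rewrite -powRrM mulVf// powRr1// fine_ge0.
Qed.

Lemma Wp_le_cost (mu nu : Pp p T) g C :
  couplings mu nu g -> (cost g <= C%:E)%E -> Wp mu nu <= C `^ p^-1.
Proof.
move=> gc gC; have C0 : 0 <= C by rewrite -lee_fin (le_trans (cost_ge0 g)).
have inf_le : (ereal_inf [set (cost h) `^ p^-1 | h in couplings mu nu] <= (C `^ p^-1)%:E)%E.
  apply: (@le_trans _ _ ((cost g) `^ p^-1)%E).
    by apply: ereal_inf_lbound; exists g.
  rewrite -poweR_EFin; apply: gt0_ler_poweR; rewrite ?invr_ge0// in_itv/= leey andbT.
    exact: cost_ge0.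
  by rewrite lee_fin.
rewrite -lee_fin /Wp fineK// ge0_fin_numE.
  by rewrite (le_lt_trans inf_le)// ltry.
by apply: le_ereal_inf_tmp => _ [h _ <-]; exact: poweR_ge0.
Qed.

Lemma Wp_lt_thicken (mu nu : Pp p T) r e : 0 < r -> 0 < e ->
  Wp mu nu < e `^ p^-1 * r -> thicken_le r e mu nu /\ thicken_le r e nu mu.
Proof.
move=> r0 e0 /Wp_lt_coupling[g gc gle]; apply: (coupling_thicken gc r0).
by rewrite powRM ?powR_ge0 ?(ltW r0)// -powRrM mulVf// powRr1 ?(ltW e0)// in gle.
Qed.

(** The couplings that have an explicit formula (the diagonal one, and the one
    with a Dirac mass) are images of a single measure. *)
Lemma Wp_image_le (m : probability (borel T) R) (mu nu : Pp p T)
    (f : borel T -> borel (T * T)%type) C :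
  measurable_fun setT f ->
  (forall A : set (borel T), measurable A -> m ((fst \o f) @^-1` A) = mu A) ->
  (forall A : set (borel T), measurable A -> m ((snd \o f) @^-1` A) = nu A) ->
  (\int[m]_x (mdist ((f x).1 : T) (f x).2 `^ p)%:E <= C%:E)%E ->
  Wp mu nu <= C `^ p^-1.
Proof.
move=> mf f1 f2 fC.
pose F : {mfun borel T >-> borel (T * T)%type} :=
  HB.pack f (isMeasurableFun.Build _ _ _ _ _ mf).
apply: (@Wp_le_cost _ _ (distribution m F)).
  by move=> A mA; split; [exact: f1|exact: f2].
rewrite /cost ge0_integral_distribution//; first exact: measurable_cost.
by move=> z; rewrite lee_fin powR_ge0.
Qed.

Lemma Wp_refl (mu : Pp p T) : Wp mu mu = 0.
Proof.
apply/eqP; rewrite eq_le Wp_ge0 andbT -(@powR0 _ p^-1) ?invr_neq0//.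
have md : measurable_fun setT ((fun x => (x, x)) : borel T -> borel (T * T)%type).
  apply: measurable_fun_generated => U oU; apply: sub_sigma_algebra.
  have /continuousP/(_ _ oU) : continuous (fun x : T => (x, x)).
    by move=> x; apply: cvg_pair; exact: cvg_id.
  by [].
apply: (Wp_image_le (m := mu) md) => //=.
by under eq_integral => x _ do rewrite mdistxx powR0//; rewrite integral0.
Qed.

Lemma measurable_pair1 (x : T) :
  measurable_fun setT ((fun y => (x, y)) : borel T -> borel (T * T)%type).
Proof.
apply: measurable_fun_generated => U oU; apply: sub_sigma_algebra.
have /continuousP/(_ _ oU) : continuous (fun y : T => (x, y)).
  by move=> y; apply: cvg_pair; [exact: cvg_cst|exact: cvg_id].
by [].
Qed.

Lemma measurable_pair2 (x : T) :
  measurable_fun setT ((fun y => (y, x)) : borel T -> borel (T * T)%type).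
Proof.
apply: measurable_fun_generated => U oU; apply: sub_sigma_algebra.
have /continuousP/(_ _ oU) : continuous (fun y : T => (y, x)).
  by move=> y; apply: cvg_pair; [exact: cvg_id|exact: cvg_cst].
by [].
Qed.

Lemma Wp_dirac_le (mu : Pp p T) x C : (moment mu x <= C%:E)%E ->
  Wp (dirac_Pp p x) mu <= C `^ p^-1.
Proof.
move=> muC; apply: (Wp_image_le (m := mu) (measurable_pair1 x)) => // A mA.
rewrite /= diracE; have [xA|xA] := pselect (A x).
  by rewrite mem_set//= preimage_cst ?mem_set// probability_setT.
by rewrite memNset//= preimage_cst memNset// measure0.
Qed.

(** The first coordinate of a coupling with the Dirac mass at x is almost
    surely x, so that every such coupling has cost moment mu x. *)
Lemma moment_le_Wp_dirac (mu : Pp p T) x e : Wp (dirac_Pp p x) mu < e ->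
  (moment mu x <= (e `^ p)%:E)%E.
Proof.
move=> /Wp_lt_coupling[g gc]; apply: le_trans.
have mf := @measurable_mdist_powR R T p x.
rewrite /moment -(integral_coupling_snd gc mf) => [|y]; last by rewrite lee_fin powR_ge0.
have mx : measurable ([set x] : set (borel T)).
  by apply: compact_measurable; exact: compact_set1.
have mE := measurable_preimageT (@measurable_fst_borel R T) mx.
have gx : g (fst @^-1` [set x]) = 1%E by rewrite (gc _ mx).1 /= diracE mem_set.
rewrite /cost (ae_eq_integral (fun z : borel (T * T)%type => (mdist (z.1 : T) z.2 `^ p)%:E))//.
- exact: measurableT_comp mf (@measurable_snd_borel R T).
- exact: measurable_cost.
exists (~` (fst @^-1` [set x])); split; first exact: measurableC.
  by apply: probability_setC0 => //; rewrite gx.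
move=> z /= nz zx; apply: nz => _; by rewrite zx.
Qed.

(** A weak form of the triangle inequality through a Dirac mass: the distances
    to it control the moments of mu and nu, and these control the cost of any
    coupling whatsoever. *)
Lemma Wp_bounded (mu nu : Pp p T) x e :
  Wp (dirac_Pp p x) mu < e -> Wp (dirac_Pp p x) nu < e ->
  Wp mu nu <= (2 `^ p * (e `^ p + e `^ p)) `^ p^-1.
Proof.
move=> mue nue; have [g gc] := couplings_neq0 mu nu.
apply: (Wp_le_cost gc); apply: (le_trans (cost_le_moments gc x)).
rewrite EFinM EFinD lee_wpmul2l ?lee_fin ?powR_ge0//.
by apply: leeD; exact: moment_le_Wp_dirac.
Qed.

End transport_cost.

(** * Density of uniform measures on finitely many points *)

Lemma integral_mrestr d (S : measurableType d) (R : realType)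
    (m : {measure set S -> \bar R})
    (E : set S) (mE : measurable E) (f : S -> \bar R) :
  measurable_fun setT f -> (forall x, 0 <= f x)%E ->
  (\int[mrestr m mE]_x f x = \int[m]_(x in E) f x)%E.
Proof.
move=> mf f0; rewrite -(setUv E) ge0_integral_setU//; last first.
- exact/disj_setPCl.
- by rewrite setUv.
- exact: measurableC.
rewrite [X in (_ + X)%E](_ : _ = 0%E) ?adde0; last first.
  apply: null_set_integral; first exact: measurableC.
    exact: measurable_funTS.
  by rewrite -[LHS]/(m (~` E `&` E)) setICl measure0.
by apply: eq_measure_integral => A mA AE; rewrite -[LHS]/(m (A `&` E)) setIidl.
Qed.

Section finite_plans.
Context (R : realType) (T : pmetricType R) (mu : probability (borel T) R).

Local Notation pair2 y := ((fun x => (x, y)) : borel T -> borel (T * T)%type).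

(** The plan that sends the part of mu in E, multiplied by c, to the point y. *)
Lemma exists_slice_plan (c : R) (E : set (borel T)) (y : T) :
  0 <= c -> measurable E ->
  exists M : {measure set (borel (T * T)%type) -> \bar R},
  (forall F, M F = c%:E * mu (pair2 y @^-1` F `&` E))%E /\
  (forall f : borel (T * T)%type -> \bar R, measurable_fun setT f -> (forall z, 0 <= f z)%E ->
    \int[M]_z f z = c%:E * \int[mu]_(x in E) f (x, y))%E.
Proof.
move=> c0 mE; have mp := measurable_pair2 y.
pose m := measure_function_pushforward__canonical__measure_function_Measure
  (mrestr mu mE) mp.
exists (mscale (NngNum c0) m); split=> // f mf f0.
rewrite ge0_integral_mscale//= ge0_integral_pushforward//.
rewrite preimage_setT integral_mrestr//.
  by have := measurableT_comp mf mp.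
by move=> x; exact: f0.
Qed.

Lemma exists_finite_plan n (c : nat -> R) (E : nat -> set (borel T)) (y : nat -> T) :
  (forall j, 0 <= c j) -> (forall j, measurable (E j)) ->
  exists M : {measure set (borel (T * T)%type) -> \bar R},
  (forall F, M F = \sum_(j < n) (c j)%:E * mu (pair2 (y j) @^-1` F `&` E j))%E /\
  (forall f : borel (T * T)%type -> \bar R, measurable_fun setT f -> (forall z, 0 <= f z)%E ->
    \int[M]_z f z = \sum_(j < n) (c j)%:E * \int[mu]_(x in E j) f (x, y j))%E.
Proof.
move=> c0 mE; have /choice[M MP] j := @exists_slice_plan (c j) (E j) (y j) (c0 j) (mE j).
exists (msum M n); split=> [F|f mf f0].
  by rewrite /msum; apply: eq_bigr => j _; exact: (MP j).1.
by rewrite ge0_integral_measure_sum//; apply: eq_bigr => j _; exact: (MP j).2.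
Qed.

End finite_plans.

Section probability_of_measure.
Context d (S : measurableType d) (R : realType).
Variables (M : {measure set S -> \bar R}) (M1 : M setT = 1%E).

(** The proof is an argument so that the instances below can be inferred. *)
Definition probability_of_measure of M setT = 1%E : set S -> \bar R := M.

HB.instance Definition _ := Measure.on (probability_of_measure M1).
HB.instance Definition _ := Measure_isProbability.Build _ _ _
  (probability_of_measure M1) M1.

End probability_of_measure.

Lemma sum_nth_default (R : realType) (T : Type) (x0 : T) (s : seq T) n
    (f : T -> R) : (size s <= n)%N ->
  \sum_(i < n) f (nth x0 s i) = \sum_(y <- s) f y + (n - size s)%:R * f x0.
Proof.
move=> sn; rewrite -(big_mkord xpredT (fun i => f (nth x0 s i))).
rewrite (big_cat_nat (leq0n _) sn)/=; congr (_ + _).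
  by rewrite [RHS](big_nth x0).
rewrite big_nat_cond; under eq_bigr => i do
  (rewrite andbT => /andP[si _]; rewrite (nth_default _ si)).
by rewrite -big_nat_cond sumr_const_nat mulr_natl.
Qed.

Lemma sum_flatten_nseq (R : realType) (T : Type) (k : nat -> nat) (a : nat -> T) n
    (f : T -> R) :
  \sum_(y <- flatten [seq nseq (k j) (a j) | j <- iota 0 n]) f y =
  \sum_(j < n) (k j)%:R * f (a j).
Proof.
rewrite big_flatten big_map -[n in iota _ n]subn0 -/(index_iota 0 n) big_mkord.
by apply: eq_bigr => j _; rewrite big_nseq iter_addr_0 mulr_natl.
Qed.

Lemma size_flatten_nseq (T : Type) (k : nat -> nat) (a : nat -> T) n :
  size (flatten [seq nseq (k j) (a j) | j <- iota 0 n]) = (\sum_(j < n) k j)%N.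
Proof.
rewrite size_flatten sumnE !big_map -[n in iota _ n]subn0 -/(index_iota 0 n) big_mkord.
by apply: eq_bigr => j _; rewrite size_nseq.
Qed.

(** The measure mu is split along the disjoint sets A j, j < n, with union U.
    A uniform measure on N.+1 points can only give mass k / N.+1 to a point, so
    from A j of mass m j a fraction c j is sent to a j, chosen such that the
    mass sent is m j rounded down to a multiple of 1 / N.+1.  The rest of A j,
    of mass at most 1 / N.+1, goes to x0, as does the complement of U. *)
Section transport_to_empirical.
Context (R : realType) (p : R) (T : pmetricType R).
Variables (mu : Pp p T) (n : nat) (A : nat -> set (borel T)) (a : nat -> T) (x0 : T).
Hypotheses (mA : forall j, measurable (A j)) (tA : trivIset setT A).
Variable N : nat.

Let U : set (borel T) := \big[setU/set0]_(j < n) A j.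
Let m j : R := fine (mu (A j)).
Let M : R := N.+1%:R.
Let k j := Num.truncn (M * m j).
Let c j : R := (k j)%:R / (M * m j).

Let mU : measurable U. Proof. exact: bigsetU_measurable. Qed.
Let M0 : 0 < M. Proof. by rewrite ltr0n. Qed.

Let mE j : mu (A j) = (m j)%:E.
Proof. by rewrite fineK// fin_num_measure. Qed.

Let m_ge0 j : 0 <= m j. Proof. exact: fine_ge0. Qed.

Let k_itv j : (k j)%:R <= M * m j < (k j).+1%:R.
Proof. by apply: Num.Theory.truncn_itv; rewrite mulr_ge0// ltW. Qed.

Let c_ge0 j : 0 <= c j.
Proof. by rewrite divr_ge0// mulr_ge0// ltW. Qed.

Let c_le1 j : c j <= 1.
Proof.
have [m0|m0] := eqVneq (m j) 0; first by rewrite /c m0 mulr0 invr0 mulr0.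
have Mm0 : 0 < M * m j by rewrite mulr_gt0// lt0r m0 m_ge0.
rewrite /c ler_pdivrMr// mul1r.
by have /andP[] := k_itv j.
Qed.

Let c_mass j : c j * m j = (k j)%:R / M.
Proof.
have [m0|m0] := eqVneq (m j) 0.
  have /andP[+ _] := k_itv j; rewrite m0 !mulr0 lern0 => /eqP ->.
  by rewrite mul0r.
by rewrite /c invfM mulrA mulrVK ?unitfE.
Qed.

Let residual_mass j : (1 - c j) * m j <= M^-1.
Proof.
rewrite mulrBl mul1r c_mass lerBlDr -[X in X + _]mul1r -mulrDl ler_pdivlMr//.
by have /andP[_ /ltW] := k_itv j; rewrite mulrC -natr1 addrC.
Qed.

Let massE (F : set (borel T)) : measurable F ->
  (mu F = \sum_(j < n) mu (F `&` A j) + mu (F `&` ~` U))%E.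
Proof.
move=> mF; rewrite (measureDI mu mF mU) -setDE addeC; congr (_ + _)%E.
rewrite /U big_distrr/= (measure_bigsetU mu (F := fun j => F `&` A j))//.
  by move=> j; exact: measurableI.
exact: trivIset_setIl.
Qed.

Let sum_mass : mu (~` U) = (1 - \sum_(j < n) m j)%:E.
Proof.
have := massE measurableT; rewrite [LHS]probability_setT setTI.
under eq_bigr => j _ do rewrite setTI mE.
rewrite sumEFin -(fineK (fin_num_measure mu _ (measurableC mU))) -EFinD.
by move=> [->]; congr _%:E; rewrite addrAC subrr add0r.
Qed.

Let sum_k : (\sum_(j < n) k j <= N.+1)%N.
Proof.
rewrite -(ler_nat R) natr_sum -/M.
apply: (@le_trans _ _ (\sum_(j < n) M * m j)).
  by apply: ler_sum => j _; have /andP[] := k_itv j.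
rewrite -mulr_sumr ler_piMr ?(ltW M0)//.
by rewrite -subr_ge0 -lee_fin -sum_mass.
Qed.

(* The default value x0 of nth fills up the N.+1 places. *)
Let x (i : 'I_N.+1) : T :=
  nth x0 (flatten [seq nseq (k j) (a j) | j <- iota 0 n]) i.

Let empirical_xE (F : set (borel T)) : empirical x F =
  (\sum_(j < n) (k j)%:R / M * \1_F (a j) +
   (1 - \sum_(j < n) (k j)%:R / M) * \1_F x0)%:E.
Proof.
rewrite empiricalE; congr _%:E.
rewrite (sum_nth_default x0 (n := N.+1) (\1_F : T -> R)) size_flatten_nseq//.
rewrite sum_flatten_nseq natrB// natr_sum -/M mulrDr mulr_sumr mulrA mulrBr.
rewrite mulVf ?gt_eqF// mulr_sumr; congr (_ + (_ - _) * _).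
  by apply: eq_bigr => j _; rewrite mulrCA mulrA.
by apply: eq_bigr => j _; rewrite mulrC.
Qed.

Lemma transport_to_empirical (D : nat -> R) : (forall j, 0 <= D j) ->
  (forall j y, A j y -> mdist (y : T) x0 `^ p <= D j) ->
  exists x' : 'I_N.+1 -> T, exists2 g, couplings mu (empirical_Pp p x') g &
  (cost p g <= \sum_(j < n) \int[mu]_(y in A j) (mdist (y : T) (a j) `^ p)%:E +
    ((\sum_(j < n) D j) / N.+1%:R)%:E +
    \int[mu]_(y in ~` \big[setU/set0]_(j < n) A j) (mdist (y : T) x0 `^ p)%:E)%E.
Proof.
move=> D0 AD; exists x.
(* The three parts of the plan: what is sent from A j to a j, the residual
   mass of A j sent to x0, and the complement of U sent to x0. *)
have [M1 [M1E M1I]] := @exists_finite_plan _ _ mu n c A a c_ge0 mA.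
have [|M2 [M2E M2I]] := @exists_finite_plan _ _ mu n (fun j => 1 - c j) A (fun=> x0) _ mA.
  by move=> j; rewrite subr_ge0.
have [||M3 [M3E M3I]] := @exists_finite_plan _ _ mu 1 (fun=> 1) (fun=> ~` U) (fun=> x0).
- by [].
- by move=> _; exact: measurableC.
pose g : {measure set (borel (T * T)%type) -> \bar R} :=
  measure_add M1 (measure_add M2 M3).
have gE F : (g F = M1 F + (M2 F + M3 F))%E.
  by rewrite [LHS]measure_addE; congr (_ + _)%E; exact: measure_addE.
have g_fst (F : set (borel T)) : measurable F -> g (fst @^-1` F) = mu F.
  move=> mF; rewrite gE M1E M2E M3E big_ord1 mul1e addeA -big_split/= [RHS]massE//.
  congr (_ + _)%E; apply: eq_bigr => j _.
  rewrite -[mu _]fineK ?fin_num_measure//; last exact: measurableI.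
  by rewrite -!EFinM -EFinD -mulrDl addrC subrK mul1r.
have g1 : g setT = 1%E.
  by rewrite -(preimage_setT fst) g_fst//; exact: probability_setT.
have slice (y : T) (F E : set (borel T)) (e : R) : mu E = e%:E ->
    mu ((fun z : borel T => (z, y)) @^-1` (snd @^-1` F) `&` E) = (e * \1_F y)%:E.
  move=> Ee; rewrite indicE; have [Fy|Fy] := pselect (F y).
    rewrite mem_set// mulr1 -Ee; congr (mu _).
    by apply/seteqP; split=> [z []|z].
  rewrite memNset// mulr0 (_ : _ `&` _ = set0) ?measure0//.
  by apply/seteqP; split=> [z []|z].
exists (probability_of_measure g1).
  move=> F mF; split; first exact: g_fst.
  rewrite [LHS]gE M1E M2E M3E big_ord1 mul1e [RHS]empirical_xE.
  under eq_bigr => j _ do rewrite (slice _ _ _ _ (mE j)) -EFinM mulrA c_mass.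
  under [X in (_ + (X + _))%E]eq_bigr => j _ do
    rewrite (slice _ _ _ _ (mE j)) -EFinM mulrA mulrBl c_mass mul1r.
  rewrite (slice _ _ _ _ sum_mass) !sumEFin -!EFinD; congr _%:E; congr (_ + _).
  by rewrite -mulr_suml -mulrDl sumrB; congr (_ * _); ring.
rewrite /cost -[leLHS]/(\int[g]_z (mdist (z.1 : T) z.2 `^ p)%:E)%E.
have mc := @measurable_cost R p T.
have c0 z : (0 <= (mdist (z.1 : T) (z.2 : T) `^ p)%:E :> \bar R)%E.
  by rewrite lee_fin powR_ge0.
rewrite ge0_integral_measure_add// ge0_integral_measure_add//.
rewrite M1I// M2I// M3I// big_ord1 mul1e addeA leeD2r//; apply: leeD.
  apply: lee_sum => j _; rewrite -[leRHS]mul1e; apply: lee_wpmul2r.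
    by apply: integral_ge0 => y _; exact: c0.
  by rewrite lee_fin.
rewrite mulr_suml -sumEFin; apply: lee_sum => j _.
have mf : measurable_fun setT (fun y : borel T => (mdist (y : T) x0 `^ p)%:E).
  exact: measurableT_comp mc (measurable_pair2 x0).
apply: (@le_trans _ _ ((1 - c j)%:E * (D j * m j)%:E)%E).
  apply: lee_wpmul2l; first by rewrite lee_fin subr_ge0.
  rewrite EFinM -mE -integral_cst//; apply: ge0_le_integral => //.
  - exact: measurable_funTS.
  - by move=> y Ay; rewrite lee_fin; exact: AD.
by rewrite -EFinM lee_fin mulrCA ler_wpM2l.
Qed.

End transport_to_empirical.

Section empirical_dense.
Context (R : realType) (p : R) (T : pmetricType R).
Hypothesis p_gt0 : 0 < p.

Let p_ge0 : 0 <= p. Proof. exact: ltW. Qed.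
Let p_neq0 : p != 0. Proof. by rewrite gt_eqF. Qed.

(** By absolute continuity of the integral it suffices that the complement of K
    has small mass. *)
Lemma moment_tail (mu : Pp p T) x e : 0 < e ->
  exists2 K : set T, compact K &
    (\int[mu]_(y in ~` K) (mdist (y : T) x `^ p)%:E <= e%:E)%E.
Proof.
move=> e0.
have mf : measurable_fun setT (fun y : borel T => mdist (y : T) x `^ p).
  by apply/measurable_EFinP; exact: measurableT_comp (@measurable_cost R p T) (measurable_pair2 x).
have f0 (y : borel T) : `|mdist (y : T) x `^ p| = mdist (y : T) x `^ p.
  by rewrite ger0_norm// powR_ge0.
have fin : (\int[mu]_y (mdist (y : T) x `^ p)%:E < +oo)%E.
  under eq_integral => y _ do rewrite metric_sym.
  exact: moment_lty.
have intf : mu.-integrable setT (EFin \o (fun y : borel T => mdist (y : T) x `^ p)).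
  apply/integrableP; split; first exact/measurable_EFinP.
  by under eq_integral => y _ do rewrite /= f0.
have [dl [dl0 dlP]] := integral_normr_continuous intf e0.
have : ((1 - dl)%:E < mu setT)%E.
  rewrite (_ : mu setT = 1%E); last exact: probability_setT.
  by rewrite lte_fin ltrBlDr ltrDl.
rewrite (@Pp_radon _ _ _ mu)// => /ereal_sup_gt[_ [K [cK _] <-] dlK].
have mK := compact_measurable cK.
exists K => //.
have Kdl : (mu (~` K) < dl%:E)%E by exact: probability_setC_lt.
have /ltW := dlP _ (measurableC mK) Kdl.
rewrite -lee_fin /Rintegral fineK; last first.
  rewrite ge0_fin_numE; last by apply: integral_ge0 => y _; rewrite lee_fin.
  under eq_integral => y _ do rewrite f0.
  apply: le_lt_trans fin; apply: ge0_subset_integral => //.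
  - exact: measurableC.
  - exact/measurable_EFinP.
  - by move=> y _; rewrite lee_fin powR_ge0.
by under eq_integral => y _ do rewrite f0.
Qed.

(** Outside of a compact set K all mass is sent to a base point, at a cost of at
    most c since the moment is finite.  K is cut into pieces of radius r, which costs
    at most c, and the rounding error is at most c for N large enough. *)
Lemma empirical_dense (mu : Pp p T) e : 0 < e ->
  exists N (x : 'I_N.+1 -> T), Wp mu (empirical_Pp p x) < e.
Proof.
move=> e0; have e2 : 0 < e / 2 by rewrite divr_gt0.
pose c := (e / 2) `^ p / 3.
have c0 : 0 < c by rewrite divr_gt0// powR_gt0.
pose r := c `^ p^-1.
have r0 : 0 < r by exact: powR_gt0.
have rp : r `^ p = c by rewrite -powRrM mulVf// powRr1// ltW.
have [K cK tail] := moment_tail mu point c0.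
have mK := compact_measurable cK.
have [n [a [_ Ka]]] := compact_net cK r0.
pose B j := thicken [set a j] r.
have mB j : measurable (B j : set (borel T)) by exact: measurable_thicken.
pose A j : set (borel T) := K `&` seqDU B j.
have mA j : measurable (A j).
  apply: measurableI => //; apply: measurableD => //.
  by apply: bigsetU_measurable => i _.
have tA : trivIset setT A by apply: trivIset_setIl; exact: trivIset_seqDU.
have AB j y : A j y -> mdist (y : T) (a j) < r.
  by case=> _ [[_ -> ay] _]; rewrite metric_sym.
pose D j := (r + mdist (a j) point) `^ p.
have D0 j : 0 <= D j by exact: powR_ge0.
have AD j y : A j y -> mdist (y : T) point `^ p <= D j.
  move=> Ay; apply: ge0_ler_powR; rewrite ?nnegrE ?addr_ge0 ?mdist_ge0 ?(ltW r0)//.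
  by rewrite (le_trans (metric_triangle _ (a j) _))// lerD2r ltW// AB.
pose N := Num.truncn ((\sum_(j < n) D j) / c).
have [x [g gc gcost]] :=
  transport_to_empirical mu n a (x0 := point) mA tA N D0 AD.
exists N, x.
suff costC : (cost p g <= ((e / 2) `^ p)%:E)%E.
  apply: le_lt_trans (Wp_le_cost p_gt0 gc costC) _.
  by rewrite -powRrM divff// powRr1 ?(ltW e2)//; lra.
apply: (le_trans gcost).
have -> : (e / 2) `^ p = c + c + c by rewrite /c; lra.
rewrite !EFinD; apply: leeD; first apply: leeD.
- apply: (@le_trans _ _ (\sum_(j < n) c%:E * mu (A j))%E).
    apply: lee_sum => j _; rewrite -integral_cst//; apply: ge0_le_integral => //.
    + by move=> y _; rewrite lee_fin powR_ge0.
    + apply: measurable_funTS.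
      exact: measurableT_comp (@measurable_cost R p T) (measurable_pair2 (a j)).
    + move=> y Ay; rewrite lee_fin -rp.
      by apply: ge0_ler_powR; rewrite ?nnegrE ?mdist_ge0 ?(ltW r0)// ltW// AB.
  rewrite -ge0_sume_distrr; last by move=> j _; exact: measure_ge0.
  rewrite -[leRHS]mule1; apply: lee_wpmul2l; first by rewrite lee_fin ltW.
  rewrite -(measure_bigsetU mu mA tA); apply: probability_le1.
  exact: bigsetU_measurable.
- rewrite lee_fin ler_pdivrMr// mulrC -ler_pdivrMr//.
  by apply/ltW; exact: truncnS_gt.
- apply: le_trans tail; apply: ge0_subset_integral.
  + by apply: measurableC; exact: bigsetU_measurable.
  + exact: measurableC.
  + apply: measurable_funTS.
    exact: measurableT_comp (@measurable_cost R p T) (measurable_pair2 point).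
  + by move=> y _; rewrite lee_fin powR_ge0.
  + apply: subsetC => y Ky; rewrite /A -big_distrr/= -bigsetU_seqDU; split=> //.
    have [_ [j /= jn <-] ajy] := Ka _ Ky.
    by rewrite -bigcup_mkord; exists j => //; exists (a j).
Qed.

End empirical_dense.

(** * Finite unions of balls in the factors and in the ultralimit *)

Section ultrafilter_facts.
Context (w : nonprincipal_ultrafilter).

Lemma ultrafilter_bigcup n (F : nat -> set nat) :
  w (\bigcup_(j < n) F j) -> exists2 j, (j < n)%N & w (F j).
Proof.
move=> wF; apply: contrapT => noF.
suff : w (\bigcap_(j < n) ~` F j).
  move=> wG; have [i [[j jn Fji] /(_ _ jn)]] := filter_ex (filterI wF wG).
  by [].
have {wF noF} : forall j, (j < n)%N -> w (~` F j).
  by move=> j jn; apply/ultrafilter_setC => wFj; apply: noF; exists j.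
elim: n => [|n IH] wF; first by apply: filterS filterT => i _ j.
apply: filterS2 (IH (fun j jn => wF j (ltnW jn))) (wF n (ltnSn n)) => i h1 h2 j /=.
by rewrite ltnS leq_eqVlt => /predU1P[->//|]; exact: h1.
Qed.

Lemma ultrafilter_forall (I : finType) (F : I -> nat -> Prop) :
  (forall j, w [set i | F j i]) -> w [set i | forall j, F j i].
Proof. by move=> wF; apply: filter_forall; exact: wF. Qed.

Lemma hst_le (R : realType) (x : nat -> R) c :
  hfinite (uclass w x) -> w [set i | x i <= c] -> hst (uclass w x) <= c.
Proof.
move=> fx xc; apply/ler_addgt0Pr => e e0.
have /happrox_stdP/(_ _ e0) xst := happrox_hst fx.
have [i [/= ]] := filter_ex (filterI xc xst).
by rewrite ltr_norml => ? /andP[? ?]; lra.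
Qed.

Lemma hst_lt (R : realType) (x : nat -> R) c :
  hfinite (uclass w x) -> hst (uclass w x) < c -> w [set i | x i < c].
Proof.
move=> fx xc; have c0 : 0 < c - hst (uclass w x) by rewrite subr_gt0.
have /happrox_stdP/(_ _ c0) xst := happrox_hst fx.
by apply: filterS xst => i /=; rewrite ltr_norml => /andP[_]; rewrite ltrBlDr subrK.
Qed.

End ultrafilter_facts.

Section nets.
Context (w : nonprincipal_ultrafilter) (R : realType) (X : nat -> pmetricType R).
Implicit Types u v : uspace_lim w X.

Local Notation Xhat := (ultralimit w X).
Local Notation st u := (st_ultralimit u : Xhat).

Lemma ultralimit_dist_lt u v r : mdist (st u) (st v) < r ->
  w [set i | mdist (urep (sval u) i) (urep (sval v) i) < r].
Proof. by rewrite ultralimit_distE => /hst_lt; apply; exact: uspace_lim_fin. Qed.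

Lemma ultralimit_dist_le u v r :
  w [set i | mdist (urep (sval u) i) (urep (sval v) i) <= r] ->
  mdist (st u) (st v) <= r.
Proof. by rewrite ultralimit_distE; apply: hst_le; exact: uspace_lim_fin. Qed.

Variables (n : nat) (a : nat -> uspace_lim w X).

Definition internal_net r : forall i, set (X i) :=
  fun i => thicken ((fun j => urep (sval (a j)) i) @` `I_n) r.

Definition hat_net r : set Xhat := thicken ((fun j => st (a j)) @` `I_n) r.

Lemma borel_family_internal_net r : borel_family (internal_net r).
Proof. by move=> i; exact: measurable_thicken. Qed.

Lemma st_preimage_hat_net r :
  st_preimage (hat_net r) `<=` internal_set w (internal_net r).
Proof.
move=> _ [u [_ [j jn <-] /ultralimit_dist_lt ju] <-].
by apply: filterS ju => i /= ju; exists (urep (sval (a j)) i) => //; exists j.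
Qed.

(** A point at bounded distance from a point of the limit part belongs to it,
    so that internal nets lie in the domain of the standard part map. *)
Lemma near_lim u (x : uspace w X) r :
  w [set i | mdist (urep (sval u) i) (urep x i) < r] ->
  hfinite (udist (fun i => @mdist R (X i)) (uclass w (fun i => point : X i)) x).
Proof.
case: u => u /= /hfiniteP[M uM] ux; apply/hfiniteP; exists (M + r).
apply: filterS2 uM ux => i /= uM ux; rewrite ger0_norm ?mdist_ge0//.
rewrite (le_trans (metric_triangle _ (urep u i) _))// lerD//; last exact: ltW.
by rewrite (le_trans (ler_norm _)).
Qed.

(** The nearest centre may depend on the index, but, there being finitely many
    centres, one of them is near for almost all indices. *)
Lemma internal_net_sub r s : r < s ->
  internal_set w (internal_net r) `<=` st_preimage (hat_net s).
Proof.
move=> rs x xr.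
have : w (\bigcup_(j < n) [set i | mdist (urep (sval (a j)) i) (urep x i) < r]).
  by apply: filterS xr => i [_ [j jn <-] jx]; exists j.
move=> /ultrafilter_bigcup[j jn jx].
have xlim := near_lim jx.
exists (exist _ x xlim) => //; exists (st (a j)); first by exists j.
apply: le_lt_trans rs; apply: ultralimit_dist_le.
by apply: filterS jx => i /= /ltW.
Qed.

End nets.
Arguments internal_net {w R X} n a r i _.
Arguments hat_net {w R X} n a r _.

(** * Pushforwards of Loeb measures *)

Section loeb_of_nets.
Context (w : nonprincipal_ultrafilter) (R : realType) (p : R).
Context (X : nat -> pmetricType R).
Implicit Type um : uPp w p X.

Local Notation Xhat := (ultralimit w X).

Lemma loeb_le um A B : A `<=` B -> (loeb um A <= loeb um B)%E.
Proof. exact: le_outer_measure. Qed.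

Lemma loeb_internal um B : borel_family B ->
  loeb um (internal_set w B) = (hst (uprob um B))%:E.
Proof.
move=> mB; rewrite -loeb_premeasureE//.
by apply: measurable_mu_extE; exists B.
Qed.

Section pushforward.
Variables (um : uPp w p X) (m : Pp p Xhat).
Hypothesis mE : forall B : set (borel Xhat), measurable B ->
  m B = loeb_pushforward um B.

Lemma pushforward_hat_net_le n a r e : 0 < e ->
  w [set i | (m (hat_net n a r) <= urep um i (internal_net n a r i) + e%:E)%E].
Proof.
move=> e0; have mB := @borel_family_internal_net w R X n a r.
have : (m (hat_net n a r) <= (hst (uprob um (internal_net n a r)))%:E)%E.
  rewrite mE; last exact: measurable_thicken.
  by rewrite -loeb_internal//; apply: loeb_le; exact: st_preimage_hat_net.
move=> mle; have /happrox_stdP/(_ _ e0) h := happrox_hst (uprob_finite um mB).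
apply: filterS h => i /=; rewrite ltr_norml => /andP[hi _].
have fi : urep um i (internal_net n a r i) \is a fin_num.
  by apply: fin_num_measure; exact: mB.
by rewrite (le_trans mle)// -(fineK fi) -EFinD lee_fin; lra.
Qed.

Lemma le_pushforward_hat_net n a r s c : r < s ->
  w [set i | (c%:E <= urep um i (internal_net n a r i))%E] ->
  (c%:E <= m (hat_net n a s))%E.
Proof.
move=> rs ci; have mB := @borel_family_internal_net w R X n a r.
rewrite mE; last exact: measurable_thicken.
apply: (@le_trans _ _ (loeb um (internal_set w (internal_net n a r)))); last first.
  by apply: loeb_le; exact: internal_net_sub.
rewrite loeb_internal// lee_fin.
apply/ler_addgt0Pr => e e0.
have /happrox_stdP/(_ _ e0) h := happrox_hst (uprob_finite um mB).
have [i [/= ci' hi]] := filter_ex (filterI ci h).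
have fi : urep um i (internal_net n a r i) \is a fin_num.
  by apply: fin_num_measure; exact: mB.
move: ci'; rewrite -(fineK fi) lee_fin; move: hi; rewrite ltr_norml => /andP[_ hi]; lra.
Qed.

(** A Radon measure that is approximately dominated by the internal measure on
    finite unions of balls is the pushforward of the Loeb measure: unions of
    balls are the only sets that are visible both in the factors and in the
    ultralimit, and they approximate compact sets. *)
Lemma eq_pushforward (mu : Pp p Xhat) :
  (forall n a r e, 0 < r -> 0 < e ->
    w [set i | (mu (hat_net n a r) <=
                urep um i (internal_net n a (2 * r) i) + e%:E)%E]) ->
  forall B : set (borel Xhat), measurable B -> mu B = loeb_pushforward um B.
Proof.
move=> mu_um B mB; rewrite -mE//.
apply: (radon_eq_of_thicken (@Pp_radon _ _ _ mu)) => // K r e cK r0 e0.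
have r4 : 0 < r / 4 by rewrite divr_gt0.
have [n [b [bK Kb]]] := compact_net cK r4.
pose a j := uhat_rep (b j).
have ab : (fun j => st_ultralimit (a j) : Xhat) = b.
  by apply/funext => j; exact: uhat_repK.
have Ka : K `<=` hat_net n a (r / 4) by rewrite /hat_net ab.
have aK : hat_net n a (3 * (r / 4)) `<=` thicken K r.
  rewrite /hat_net ab => y [_ [j jn <-] jy]; exists (b j); first exact: bK.
  by apply: (lt_le_trans jy); lra.
have mhat s : measurable (hat_net n a s : set (borel Xhat)).
  exact: measurable_thicken.
apply: (@le_trans _ _ (mu (hat_net n a (r / 4)))).
  by apply: le_measure; rewrite ?inE//; exact: compact_measurable.
have mfin : mu (hat_net n a (r / 4)) \is a fin_num by exact: fin_num_measure.
rewrite -(fineK mfin) -leeBlDr// -EFinB.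
apply: (@le_trans _ _ (m (hat_net n a (3 * (r / 4))))); last first.
  by apply: le_measure; rewrite ?inE//; exact: measurable_thicken.
apply: (@le_pushforward_hat_net _ _ (2 * (r / 4))); first by lra.
apply: filterS (mu_um n a _ _ r4 e0) => i /=.
by rewrite -(fineK mfin) EFinB leeBlDr.
Qed.

End pushforward.
End loeb_of_nets.

Lemma thicken_le_net (w : nonprincipal_ultrafilter) (R : realType)
    (X : nat -> pmetricType R) n (a : nat -> uspace_lim w X) i (r s e : R)
    (mu nu : {measure set (borel (X i)) -> \bar R}) :
  thicken_le s e mu nu ->
  (mu (internal_net n a r i) <= nu (internal_net n a (r + s) i) + e%:E)%E.
Proof.
move=> munu; apply: (le_trans (munu _ _)); first exact: measurable_thicken.
apply: leeD2r; apply: le_measure; rewrite ?inE; [exact: measurable_thicken..|].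
exact: thicken_thicken.
Qed.

Section same_loeb_pushforward.
Context (w : nonprincipal_ultrafilter) (R : realType) (p : R).
Context (X : nat -> pmetricType R).
Hypothesis p_gt0 : 0 < p.

Lemma uWp_lt (mu nu : uPp w p X) t : 0 < t ->
  happrox (uWp mu nu) (hstd w 0) -> w [set i | Wp (urep mu i) (urep nu i) < t].
Proof.
move=> t0 /happrox_stdP/(_ _ t0); apply: filterS => i /=.
by rewrite subr0; apply: le_lt_trans; exact: ler_norm.
Qed.

Lemma loeb_pushforward_congr (um un : uPp w p X) (mu nu : Pp p (ultralimit w X)) :
  happrox (uWp um un) (hstd w 0) ->
  (forall B : set (borel (ultralimit w X)), measurable B -> mu B = loeb_pushforward um B) ->
  (forall B : set (borel (ultralimit w X)), measurable B -> nu B = loeb_pushforward un B) ->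
  forall B : set (borel (ultralimit w X)), measurable B ->
  mu B = loeb_pushforward un B.
Proof.
move=> umun muE nuE; apply: (eq_pushforward nuE) => n a r e r0 e0.
have e2 : 0 < e / 2 by rewrite divr_gt0.
have t0 : 0 < (e / 2) `^ p^-1 * r by rewrite mulr_gt0// powR_gt0.
apply: filterS2 (pushforward_hat_net_le muE n a r e2) (uWp_lt t0 umun) => i /=.
move=> mui /(Wp_lt_thicken p_gt0 r0 e2)[/thicken_le_net umun_i _].
have eE : e%:E = ((e / 2)%:E + (e / 2)%:E)%E by rewrite -EFinD -splitr.
apply: (le_trans mui); rewrite eE addeA; apply: leeD2r.
by rewrite mulr_natl mulr2n; exact: umun_i.
Qed.

End same_loeb_pushforward.

Lemma moment_empirical (R : realType) (p : R) (T : pmetricType R) n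
    (x : 'I_n.+1 -> T) y :
  moment p (empirical x) y =
  (n.+1%:R^-1 * \sum_(j < n.+1) mdist y (x j) `^ p)%:E.
Proof.
have mf := @measurable_mdist_powR R T p.
rewrite /moment /empirical ge0_integral_mscale//; last first.
- by move=> z _; rewrite lee_fin powR_ge0.
- exact: mf.
rewrite ge0_integral_measure_sum//; last first.
- exact: mf.
- by move=> z _; rewrite lee_fin powR_ge0.
under eq_bigr => j _ do rewrite (integral_dirac _ _ (mf _))// diracT mul1e inord_val.
by rewrite sumEFin -EFinM.
Qed.

(** * Liftings *)

Section lifting.
Context (w : nonprincipal_ultrafilter) (R : realType) (p : R).
Context (X : nat -> pmetricType R).
Hypothesis p_gt0 : 0 < p.

Local Notation Xhat := (ultralimit w X).
Local Notation W := (fun i => @Wp R p (X i)).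
Local Notation delta := (fun i => dirac_Pp p (point : X i)).

Lemma uPp_lim_bound (um : uPp_lim w p X) : exists M : R,
  w [set i | Wp (dirac_Pp p (point : X i)) (urep (sval um) i) < M].
Proof.
case: um => um /= /hfiniteP[M uM]; exists (M + 1).
apply: filterS2 (urep_class w delta) uM => i /= <- uM.
by rewrite (le_lt_trans (ler_norm _))// (le_lt_trans uM)// ltrDl.
Qed.

(** Without this, the standard part of the distance would be a default
    value. *)
Lemma uPp_lim_finite (um un : uPp_lim w p X) : hfinite (uWp (sval um) (sval un)).
Proof.
have [M umM] := uPp_lim_bound um; have [N unN] := uPp_lim_bound un.
pose L := Num.max M N.
apply/hfiniteP; exists ((2 `^ p * (L `^ p + L `^ p)) `^ p^-1).
apply: filterS2 umM unN => i /= umM unN; rewrite ger0_norm ?Wp_ge0//.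
by apply: (Wp_bounded p_gt0 (x := point)); rewrite lt_max ?umM ?unN ?orbT.
Qed.

(** A point of the quotient is the set of all elements at infinitesimal distance
    from a given one.  The set of un contains un, the distance of un to itself
    being 0, and it equals the set of um. *)
Lemma st_Pp_eq (um un : uPp_lim w p X) :
  st_Pp_ultralimit um = st_Pp_ultralimit un ->
  happrox (uWp (sval um) (sval un)) (hstd w 0).
Proof.
move=> /(congr1 sval) /= umun.
suff : [set y : uPp_lim w p X | happrox (udist W (sval um) (sval y)) (hstd w 0)] un by [].
rewrite umun /=; apply/happrox_stdP => e e0; apply: filterS filterT => i _ /=.
by rewrite Wp_refl// subr0 normr0.
Qed.

(** The distance on the quotient is computed with chosen representatives us and
    ut, which are only known to be infinitesimally close to um and un. *)
Lemma Pp_ultralimit_dist_lt (um un : uPp_lim w p X) r :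
  Pp_ultralimit_dist (st_Pp_ultralimit um) (st_Pp_ultralimit un) < r ->
  exists us ut : uPp w p X, [/\ happrox (uWp us (sval um)) (hstd w 0),
    w [set i | Wp (urep us i) (urep ut i) < r] &
    happrox (uWp ut (sval un)) (hstd w 0)].
Proof.
move=> umun.
exists (sval (uhat_rep (st_Pp_ultralimit um))), (sval (uhat_rep (st_Pp_ultralimit un))).
split.
- by apply: st_Pp_eq; exact: uhat_repK.
- by move: umun => /hst_lt; apply; exact: uPp_lim_finite.
- by apply: st_Pp_eq; exact: uhat_repK.
Qed.

Section empirical_lifting.
Variables (N : nat) (u : 'I_N.+1 -> uspace_lim w X).

Let emp i : Pp p (X i) := empirical_Pp p (fun j => urep (sval (u j)) i).

Definition empirical_lift : uPp w p X := uclass w emp.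

Lemma empirical_lift_lim :
  hfinite (udist W (uclass w delta) empirical_lift).
Proof.
have /choice[M uM] : forall j, exists M : R,
    w [set i | mdist (point : X i) (urep (sval (u j)) i) <= M].
  move=> j; case: (u j) => x /= /hfiniteP[M xM]; exists M.
  apply: filterS2 (urep_class w (fun i => point : X i)) xM => i /= <-.
  by apply: le_trans; exact: ler_norm.
pose C := N.+1%:R^-1 * \sum_(j < N.+1) (M j) `^ p.
apply/hfiniteP; exists (C `^ p^-1).
have uM' := ultrafilter_forall uM.
apply: filterS3 (urep_class w delta) (urep_class w emp) uM' => i /= -> -> /= uMi.
rewrite ger0_norm ?Wp_ge0//; apply: (Wp_dirac_le p_gt0).
rewrite [leLHS]moment_empirical lee_fin ler_wpM2l ?invr_ge0//.
apply: ler_sum => j _; apply: ge0_ler_powR; rewrite ?nnegrE ?mdist_ge0//.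
- exact: ltW p_gt0.
- exact: le_trans (mdist_ge0 _ _) (uMi j).
Qed.

Lemma empirical_lift_hat_net n a r :
  w [set i | (empirical (fun j => st_ultralimit (u j) : Xhat) (hat_net n a r) <=
    urep empirical_lift i (internal_net n a r i))%E].
Proof.
have near_j j : w [set i | hat_net n a r (st_ultralimit (u j)) ->
    internal_net n a r i (urep (sval (u j)) i)].
  have [uj|uj] := pselect (hat_net n a r (st_ultralimit (u j))); last first.
    by apply: filterS filterT => i _ /=.
  have /st_preimage_hat_net : st_preimage (hat_net n a r) (sval (u j)).
    by exists (u j).
  by apply: filterS => i /= + _.
apply: filterS2 (urep_class w emp) (ultrafilter_forall near_j) => i /= -> near_i.
rewrite [leRHS]empiricalE empiricalE lee_fin ler_wpM2l ?invr_ge0//.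
apply: ler_sum => j _; rewrite !indicE ler_nat.
case: (boolP (_ \in hat_net n a r)) => //; rewrite inE => /near_i uj.
by rewrite mem_set.
Qed.

End empirical_lifting.

(** The chain of measures, from mu to the lifting um, is mu, the empirical
    measure of x, the internal empirical measure ue, ut, us, um, where ut and us
    are the representatives that compute the distance of ue and um.  All steps
    but the second enlarge the radius by s = r / 4 and the mass by h = e / 4. *)
Lemma lifting_pushforward (iota : Pp p Xhat -> Pp_ultralimit w p X)
    (mu : Pp p Xhat) (um : uPp_lim w p X) (m : Pp p Xhat) :
  canonical_embedding iota -> lifting iota um mu ->
  (forall B : set (borel Xhat), measurable B -> m B = loeb_pushforward (sval um) B) ->
  forall B : set (borel Xhat), measurable B ->
  mu B = loeb_pushforward (sval um) B.
Proof.
move=> [iota_dist iota_emp] um_mu mE; apply: (eq_pushforward mE) => n a r e r0 e0.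
pose s := r / 4; pose h := e / 4.
have s0 : 0 < s by rewrite divr_gt0.
have h0 : 0 < h by rewrite divr_gt0.
pose t := h `^ p^-1 * s.
have t0 : 0 < t by rewrite mulr_gt0// powR_gt0.
have [N [x mux]] := empirical_dense p_gt0 mu t0.
pose u j := uhat_rep (x j).
have ux : (fun j => st_ultralimit (u j) : Xhat) = x.
  by apply/funext => j; exact: uhat_repK.
pose ue : uPp_lim w p X := exist _ (empirical_lift u) (empirical_lift_lim u).
have iota_x : iota (empirical_Pp p x) = st_Pp_ultralimit ue.
  rewrite -ux; apply: (iota_emp _ (fun j => urep (sval (u j)))) => // j.
  by rewrite urepK.
have : Pp_ultralimit_dist (st_Pp_ultralimit um) (st_Pp_ultralimit ue) < t.
  by rewrite um_mu -iota_x iota_dist.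
move=> /Pp_ultralimit_dist_lt[us [ut [/(uWp_lt t0) us_um us_ut /(uWp_lt t0) ut_ue]]].
have [mu_x_le _] := Wp_lt_thicken p_gt0 s0 h0 mux.
have mu_x := mu_x_le (hat_net n a r) (measurable_thicken _ r).
have emp := empirical_lift_hat_net u n a (r + s); rewrite ux in emp.
apply: filterS2 (filterI emp ut_ue) (filterI us_ut us_um) => i /= [emp_i].
move=> /(Wp_lt_thicken p_gt0 s0 h0)[_ /thicken_le_net ue_ut].
move=> [/(Wp_lt_thicken p_gt0 s0 h0)[_ /thicken_le_net ut_us]].
move=> /(Wp_lt_thicken p_gt0 s0 h0)[/thicken_le_net us_um_i _].
have eE : e%:E = (h%:E + h%:E + h%:E + h%:E)%E.
  by rewrite -!EFinD; congr _%:E; rewrite /h; lra.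
apply: (le_trans mu_x); rewrite eE !addeA; apply: leeD2r.
apply: (@le_trans _ _ (empirical x (hat_net n a (r + s)))).
  apply: le_measure; rewrite ?inE; [exact: measurable_thicken..|].
  exact: thicken_thicken.
apply: (le_trans emp_i); apply: (le_trans (ue_ut _ _ _ _)); apply: leeD2r.
apply: (le_trans (ut_us _ _ _ _)); apply: leeD2r.
apply: (le_trans (us_um_i _ _ _ _)); apply: leeD2r.
by rewrite (_ : r + s + s + s + s = 2 * r)// /s; lra.
Qed.

End lifting.

Theorem corollary24 (R : realType) (w : nonprincipal_ultrafilter)
    (p : R) (p_ge1 : 1 <= p) (X : nat -> pmetricType R) :
  (forall mu nu : uPp_lim w p X,
    happrox (uWp (sval mu) (sval nu)) (hstd w 0) ->
    loeb_pushforward_well_defined (sval mu) ->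
    in_Pp p (loeb_pushforward (sval mu)) ->
    loeb_pushforward_well_defined (sval nu) ->
    in_Pp p (loeb_pushforward (sval nu)) ->
    forall B : set (borel (ultralimit w X)), measurable B ->
      loeb_pushforward (sval mu) B = loeb_pushforward (sval nu) B)
  /\
  (forall iota : Pp p (ultralimit w X) -> Pp_ultralimit w p X,
    canonical_embedding iota ->
    forall (mu : Pp p (ultralimit w X)) (um : uPp_lim w p X),
    lifting iota um mu ->
    loeb_pushforward_well_defined (sval um) ->
    in_Pp p (loeb_pushforward (sval um)) ->
    forall B : set (borel (ultralimit w X)), measurable B ->
      mu B = loeb_pushforward (sval um) B).
Proof.
have p_gt0 : 0 < p by exact: lt_le_trans p_ge1.
split=> [um un umun _ [mu muE] _ [nu nuE] B mB|].
  by rewrite -muE//; exact: loeb_pushforward_congr umun muE nuE B mB.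
move=> iota iotaP mu um um_mu _ [m mE] B mB.
exact: lifting_pushforward iotaP um_mu mE B mB.
Qed.
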